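(* Let $\beta>0$ and $h\ge 0$. Let $\{(m_N^{\sigma}(t), m_N^{\sigma\eta}(t),\lambda_N(t))\}_{t\ge 0}$ be the order-parameter process of the $N$-spin dissipative Curie-Weiss model with random field $\eta$ described in the context. Suppose that, as $N\to\infty$, the initial condition $(m_N^{\sigma}(0), m_N^{\sigma\eta}(0),\lambda_N(0))$ converges weakly to the constant $(m_0^{\sigma}, m_0^{\sigma\eta},\lambda_0)$. Then, $\mu$-almost surely (i.e. for almost every realization of the disorder $\eta$), the stochastic process $\{(m_N^{\sigma}(t), m_N^{\sigma\eta}(t),\lambda_N(t))\}_{t\ge 0}$ converges weakly, as $N\to\infty$, in $\mathcal{D}_{\mathbb{R}^3}(\mathbb{R}^+)$ to the unique solution of \[ \left\{ \begin{array}{lcl} \dot{m}^{\sigma}_t &=& -2 m^{\sigma}_t + \tanh(\lambda_t+h)+\tanh(\lambda_t-h)\\ \dot{m}^{\sigma\eta}_t &=& -2 m^{\sigma\eta}_t + \tanh(\lambda_t+h)-\tanh(\lambda_t-h)\\ \dot{\lambda}_t &=& -\lambda_t + \beta\left[-2m^{\sigma}_t+\tanh(\lambda_t+h)+\tanh(\lambda_t-h)\right] \end{array} \right. \] with initial condition $(m_0^{\sigma}, m_0^{\sigma\eta},\lambda_0)$.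
   Context: Disorder: $\eta=(\eta_j)_{j\ge 1}$ is a sequence of i.i.d. random variables with values in $\{-1,+1\}$ and distribution $\mu=\frac12(\delta_{-1}+\delta_{+1})$; the $N$-particle system uses $(\eta_j)_{j=1}^N$. ''$\mu$-almost surely'' means for almost every realization of this sequence. Microscopic dynamics: for a given realization of $\eta$, $(\sigma(t),\lambda_N(t))_{t\ge0}$ is the Markov process on $\{-1,+1\}^N\times\mathbb{R}$ with infinitesimal generator \[ L_N^{\eta} f(\sigma,\lambda)=\sum_{j=1}^N\left[1-\sigma_j\tanh(\lambda+h\eta_j)\right]\left[f\left(\sigma^j,\lambda-\tfrac{2\beta\sigma_j}{N}\right)-f(\sigma,\lambda)\right]-\lambda\,\partial_\lambda f(\sigma,\lambda), \] where $\sigma^j$ is the configuration obtained from $\sigma$ by flipping the $j$-th spin. Equivalently, spin $i$ flips at rate $1-\tanh[\sigma_i(\lambda_N+h\eta_i)]$ and $d\lambda_N(t)=-\lambda_N(t)\,dt+\beta\,dm_N^{\sigma}(t)$. Order parameters: $m_N^{\sigma}(t)=\frac1N\sum_{j=1}^N\sigma_j(t)$ and $m_N^{\sigma\eta}(t)=\frac1N\sum_{j=1}^N\sigma_j(t)\eta_j$. With $\bar\eta_N=\frac1N\sum_{j=1}^N\eta_j$, the process $(m_N^{\sigma},m_N^{\sigma\eta},\lambda_N)$ is itself Markov (given $\eta$), with generator \[ \mathcal{L}_N f(m^{\sigma},m^{\sigma\eta},\lambda)=\sum_{j,k=\pm1}C_N(j,k)\left[f\left(m^{\sigma}-\tfrac{2j}{N},m^{\sigma\eta}-\tfrac{2jk}{N},\lambda-\tfrac{2\beta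 j}{N}\right)-f(m^{\sigma},m^{\sigma\eta},\lambda)\right]-\lambda\,\partial_\lambda f(m^{\sigma},m^{\sigma\eta},\lambda), \] where $C_N(j,k)=\frac N4(1+k\bar\eta_N+jm^{\sigma}+jkm^{\sigma\eta})[1-j\tanh(\lambda+kh)]$. $\mathcal{D}_{\mathbb{R}^3}(\mathbb{R}^+)$ is the space of càdlàg trajectories from $\mathbb{R}^+=[0,\infty)$ to $\mathbb{R}^3$ with the Skorokhod topology. *)

(* Defs.v *)
From HB Require Import structures.
From mathcomp Require Import all_boot all_order all_algebra finmap.
From mathcomp Require Import all_classical all_reals all_analysis.
Set Implicit Arguments.
Unset Strict Implicit.
Unset Printing Implicit Defensive.
Import Order.TTheory GRing.Theory Num.Theory.
Import numFieldNormedType.Exports.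
Local Open Scope classical_set_scope.
Local Open Scope ring_scope.

Definition tanh {R : realType} (x : R) : R :=
  (expR x - expR (- x)) / (expR x + expR (- x)).

(* Trajectories are total functions on R; being constant on the negative
   half-line, they are determined by their restriction to [0, +oo[. *)
Definition is_cadlag {R : realType} {E : topologicalType} (x : R -> E) : Prop :=
  [/\ forall t : R, 0 <= t -> x s @[s --> t^'+] --> x t,
      forall t : R, 0 < t -> exists l : E, x s @[s --> t^'-] --> l &
      forall t : R, t <= 0 -> x t = x 0].

Record cadlag (R : realType) (E : topologicalType) := Cadlag {
  cadlag_path :> R -> E;
  cadlagP : is_cadlag cadlag_path }.

HB.instance Definition _ (R : realType) (E : topologicalType) :=
  gen_eqMixin (cadlag R E).
HB.instance Definition _ (R : realType) (E : topologicalType) :=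
  gen_choiceMixin (cadlag R E).

Section cadlag_map.
Context {R : realType} {E E' : topologicalType} (g : E -> E').
Hypothesis cg : continuous g.

Lemma is_cadlag_comp (x : cadlag R E) : is_cadlag (g \o x).
Proof.
case: (cadlagP x) => rx lx nx; split.
- by move=> t t0; exact: (continuous_cvg _ (@cg (x t)) (rx t t0)).
- move=> t t0; have [l xl] := lx t t0; exists (g l).
  exact: (continuous_cvg _ (@cg l) xl).
- by move=> t t0 /=; rewrite nx.
Qed.

Definition cadlag_map (x : cadlag R E) : cadlag R E' := Cadlag (is_cadlag_comp x).
End cadlag_map.

(* The Skorokhod (J1) topology of D([0, +oo[, E), through the neighbourhood
   bases given by Ethier-Kurtz, Markov Processes, Prop. 3.5.3 (c): x_n --> x iff
   for all T there are time changes u_n with |u_n(t) - t| --> 0 and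
   dist(x_n(t), x(u_n(t))) --> 0 uniformly in t <= T. *)
Section skorokhod.
Context {R : realType} {E : pseudoMetricType R}.

Definition time_change (u : R -> R) : Prop :=
  (forall s t : R, 0 <= s -> s < t -> u s < u t) /\
  u @` [set t : R | 0 <= t] = [set t : R | 0 <= t].

Definition skorokhod_ball (x : cadlag R E) (T e : R) : set (cadlag R E) :=
  [set y | exists u : R -> R, time_change u /\
    forall t : R, 0 <= t <= T -> `|u t - t| < e /\ ball (x (u t)) e (y t)].

Definition skorokhod_open (U : set (cadlag R E)) : Prop :=
  forall x, U x -> exists T e : R, 0 < e /\ skorokhod_ball x T e `<=` U.

Lemma skorokhod_ball_le (x : cadlag R E) (T T' e e' : R) : T <= T' -> e' <= e ->
  skorokhod_ball x T' e' `<=` skorokhod_ball x T e.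
Proof.
move=> TT' e'e y [u [tu yu]]; exists u; split=> // t /andP[t0 tT].
have [|ut xy] := yu t; first by rewrite t0 (le_trans tT).
by split; [exact: lt_le_trans e'e|exact: le_ball xy].
Qed.

Lemma skorokhod_openT : skorokhod_open setT.
Proof. by move=> x _; exists 0, 1. Qed.

Lemma skorokhod_openI : setI_closed skorokhod_open.
Proof.
move=> U V oU oV x [/oU[T [e [e0 TU]]] /oV[T' [e' [e'0 TV]]]].
exists (Num.max T T'), (Num.min e e'); split; first by rewrite lt_min e0 e'0.
by move=> y Hy; split; [apply: TU|apply: TV]; apply: skorokhod_ball_le Hy;
  rewrite ?le_max ?ge_min lexx ?orbT.
Qed.

Lemma skorokhod_open_bigU (I : Type) (f : I -> set (cadlag R E)) :
  (forall i, skorokhod_open (f i)) -> skorokhod_open (\bigcup_i f i).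
Proof.
move=> of_ x [i _ /of_[T [e [e0 H]]]]; exists T, e; split=> //.
by move=> y /H; exists i.
Qed.

HB.instance Definition _ := isOpenTopological.Build (cadlag R E)
  skorokhod_openT skorokhod_openI skorokhod_open_bigU.

End skorokhod.

(* Weak convergence of random elements to a deterministic limit. For paths,
   F (Y N w) is measurable as soon as the one-time marginals of Y N are, since
   the Borel sigma-algebra of D is generated by the coordinate maps. *)
Definition weakly_cvg_cst {R : realType} {E : topologicalType}
    {d : nat -> measure_display} {T : forall N, measurableType (d N)}
    (Q : forall N, probability (T N) R) (Y : forall N, T N -> E) (c : E) : Prop :=
  forall F : E -> R, continuous F -> bounded_fun F ->
    (\int[Q N]_w (F (Y N w))%:E)%E @[N --> \oo] --> (F c)%:E.

Section markov.
Context {R : realType} {d d' : measure_display}.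
Context {S : measurableType d} {T : measurableType d'}.

Definition transition_semigroup (P : R -> R.-pker S ~> S) : Prop :=
  (forall (x : S) (A : set S), measurable A -> P 0 x A = \d_x A) /\
  (forall (s t : R) (x : S) (A : set S), 0 <= s -> 0 <= t -> measurable A ->
     P (s + t) x A = (\int[P s x]_y P t y A)%E).

(* On the domain D, the generator of P is L: (P_t f - f) / t --> L f as
   t --> 0+, in sup norm. *)
Definition infinitesimal_generator (P : R -> R.-pker S ~> S)
    (D : set (S -> R)) (L : (S -> R) -> (S -> R)) : Prop :=
  forall f, D f -> forall e : R, 0 < e ->
    \forall t \near (0 : R)^'+, forall x : S,
      `|((\int[P t x]_y f y) - f x) / t - L f x| < e.

Definition natural_filtration (X : R -> T -> S) (s : R) : set (set T) :=
  <<s [set B | exists (u : R) (A : set S), [/\ 0 <= u <= s, measurable A & B = X u @^-1` A]] >>.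

Definition markov_process (Q : probability T R) (X : R -> T -> S)
    (P : R -> R.-pker S ~> S) : Prop :=
  (forall t : R, 0 <= t -> measurable_fun setT (X t)) /\
  (forall (s t : R) (A : set S) (B : set T), 0 <= s -> 0 <= t -> measurable A -> natural_filtration X s B ->
     Q (B `&` X (s + t) @^-1` A) = (\int[Q]_(w in B) P t (X s w) A)%E).

Definition markov_process_with_generator (Q : probability T R) (X : R -> T -> S)
    (D : set (S -> R)) (L : (S -> R) -> (S -> R)) : Prop :=
  exists P : R -> R.-pker S ~> S,
    [/\ transition_semigroup P, infinitesimal_generator P D L &
        markov_process Q X P].

End markov.

Definition mutually_independent {R : realType} {d : measure_display}
    {Omega : measurableType d} (P : probability Omega R) (X : nat -> Omega -> R) :=
  forall (J : {fset nat}) (A : nat -> set R), (forall j, measurable (A j)) ->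
    P (\bigcap_(j in [set` J]) (X j @^-1` A j)) =
    (\prod_(j <- J) P (X j @^-1` A j))%E.

(* Sites are numbered from 0: the N-particle system uses eta 0, ..., eta N.-1. *)
Definition random_field {R : realType} {d : measure_display}
    {Omega : measurableType d} (P : probability Omega R)
    (eta : nat -> {RV P >-> R}) : Prop :=
  [/\ forall j w, eta j w = 1 \/ eta j w = -1,
      forall j (A : set R), measurable A ->
        distribution P (eta j) A = (2^-1%:E * (\d_(-1 : R)%R A + \d_(1 : R)%R A))%E &
      mutually_independent P (fun j => eta j)].

(* Spin configurations, true coding +1 and false coding -1; discrete topology
   and sigma-algebra. *)
Definition config (N : nat) : Type := {ffun 'I_N -> bool}.

HB.instance Definition _ N := Choice.on (config N).
HB.instance Definition _ N := isPointed.Build (config N) [ffun=> true].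
HB.instance Definition _ N := hasNbhs.Build (config N) principal_filter.
HB.instance Definition _ N := Discrete_ofNbhs.Build (config N) erefl.
HB.instance Definition _ N := DiscreteUniform_ofNbhs.Build (config N).
HB.instance Definition _ N := @isMeasurable.Build default_measure_display
  (config N) discrete_measurable discrete_measurable0
  discrete_measurableC discrete_measurableU.

Section model.
Context {R : realType}.
Implicit Types (beta h : R) (eta : nat -> R).

Definition spin (b : bool) : R := if b then 1 else -1.

Definition flip N (s : config N) (j : 'I_N) : config N :=
  [ffun i => if i == j then ~~ s i else s i].

Definition micro_generator beta h eta N (f : config N * R -> R) (x : config N * R) : R :=
  let: (s, l) := x in
  \sum_(j < N) (1 - spin (s j) * tanh (l + h * eta j)) *
     (f (flip s j, l - 2 * beta * spin (s j) / N%:R) - f (s, l))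
  - l * derive1 (fun l' => f (s, l')) l.

(* C^1_c in lambda. These functions form a core, so that the transition
   semigroup is uniquely determined by its generator on them. *)
Definition micro_domain N : set (config N * R -> R) :=
  [set f | forall s : config N,
    [/\ forall l : R, derivable (fun l' => f (s, l')) l 1,
        continuous (derive1 (fun l' => f (s, l'))) &
        exists K : R, forall l : R, K < `|l| -> f (s, l) = 0]].

Definition order_parameters eta N (x : config N * R) : R * R * R :=
  ((\sum_(j < N) spin (x.1 j)) / N%:R,
   (\sum_(j < N) spin (x.1 j) * eta j) / N%:R,
   x.2).

Lemma order_parameters_continuous eta N : continuous (@order_parameters eta N).
Proof.
move=> [s l].
have cs (k : config N -> R) : k x.1 @[x --> ((s, l) : config N * R)] --> k s.
  move=> A /= /nbhs_singleton kA; exists ([set s], setT) => /=.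
    by split; [rewrite nbhs_principalE|exact: filterT].
  by move=> [s' l'] /= [-> _].
have c1 := cs (fun s => (\sum_(j < N) spin (s j)) / N%:R).
have c2 := cs (fun s => (\sum_(j < N) spin (s j) * eta j) / N%:R).
exact: (cvg_pair (cvg_pair c1 c2) (@cvg_snd _ _ (nbhs s) (nbhs l) _)).
Qed.

Definition order_parameter_path eta N (x : cadlag R (config N * R)%type) :
    cadlag R (R * R * R)%type :=
  cadlag_map (@order_parameters_continuous eta N) x.

(* A solution on [0, +oo[; continuity at 0 and the equations on ]0, +oo[ give
   the one-sided derivatives at 0. *)
Definition limit_ode beta h (init : R * R * R) (y : R -> R * R * R) : Prop :=
  let m t := (y t).1.1 in let q t := (y t).1.2 in let l t := (y t).2 in
  [/\ y 0 = init,
      y t @[t --> (0 : R)^'+] --> y 0 &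
      forall t : R, 0 < t ->
      [/\ is_derive t 1 m (- 2 * m t + tanh (l t + h) + tanh (l t - h)),
          is_derive t 1 q (- 2 * q t + tanh (l t + h) - tanh (l t - h)) &
          is_derive t 1 l
            (- l t + beta * (- 2 * m t + tanh (l t + h) + tanh (l t - h)))]].

End model.

(* Main.v *)
Require Import Defs.
From HB Require Import structures.
From mathcomp Require Import all_boot all_order all_algebra finmap.
From mathcomp Require Import all_classical all_reals all_analysis.
                                                                        
                              
From mathcomp Require Import zify ring lra measurable_realfun.
Set Implicit Arguments.
Unset Strict Implicit.
Unset Printing Implicit Defensive.
Import Order.TTheory GRing.Theory Num.Theory.
Import numFieldNormedType.Exports.
Local Open Scope classical_set_scope.
Local Open Scope ring_scope.

                                                                              
                                                                             
                                                                               
                                                                               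
                                                                           
                                                                            
                                                                              
                                                                               
                                                                               
                                                                           
                      

                 

(** Fix the disorder and let y = ([ym], [yq], [yl]) solve the limit equations. The proof controls V,
    the squared distance at time t between the order parameters and y(t). The limiting vector field
    b is one-sided Lipschitz, 2 <x - x', b(x) - b(x')> <= 6 beta |x - x'|^2
    ([drift_one_sided_lipschitz]). The generator of the particle system departs from b by terms
    proportional to the empirical mean of the field, which Young's inequality absorbs, and by a
    second-order term of size 1/N, since jumps of size 1/N occur at total rate at most 2N. So the
    generator applied to V, plus the time derivative of V, is at most kappa V + error with kappa = 6
    beta + 1 ([generator_sqdist_le]).

    The domain of the generator contains only C^1 functions with compact support in lambda, so V is
    replaced by [lyapunov], the cube of the positive part of 1 - e^(-kappa t) V. It takes values in
    [0, 1], and convexity of the cube turns the bound on V into L f + df/dt >= - [drift_error]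
    ([generator_lyapunov]). Since the dynamics is known only through a semigroup whose derivative at
    0 is L, this is integrated by a Dini derivative argument applied to u -> P_u f_(t+u)
    ([semigroup_lower_bound]). By the Markov property, f_t(X_t) + c t with c = [drift_error] is then
    a submartingale. Stopping on dyadic grids, together with right continuity of paths, gives
    [markov_maximal]: outside an event of probability at most (1 - E f_0(X_0) + c tau) / a one has f
    >= 1 - a, hence e^(-kappa t) V <= a, on all of [0, tau].

    As N grows, E f_0(X_0) tends to 1 by weak convergence of the initial condition, and c tends to 0
    for almost every disorder by the strong law of large numbers ([random_field_lln]). The order
    parameters thus converge to y uniformly on bounded time intervals, in probability, which implies
    weak convergence for the Skorokhod topology because the limit is deterministic
    ([weakly_cvg_cst_skorokhod]). Existence of y is Picard iteration ([global_ode_solution]);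
    uniqueness is Gronwall's argument with the same one-sided Lipschitz estimate. *)

(** * Elementary calculus and the hyperbolic tangent *)

Section calculus.
Context {R : realType}.
Implicit Types (f g : R -> R) (x : R).

Lemma is_derive_add f g x df dg : is_derive x 1 f df -> is_derive x 1 g dg ->
  is_derive x 1 (fun t => f t + g t) (df + dg).
Proof. exact: is_deriveD. Qed.

Lemma is_derive_opp f x df : is_derive x 1 f df ->
  is_derive x 1 (fun t => - f t) (- df).
Proof. exact: is_deriveN. Qed.

Lemma is_derive_sub f g x df dg : is_derive x 1 f df -> is_derive x 1 g dg ->
  is_derive x 1 (fun t => f t - g t) (df - dg).
Proof. exact: is_deriveB. Qed.

Lemma is_derive_mul f g x df dg : is_derive x 1 f df -> is_derive x 1 g dg ->
  is_derive x 1 (fun t => f t * g t) (df * g x + f x * dg).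
Proof.
move=> fd gd; apply: (is_derive_eq (is_deriveM fd gd)).
by rewrite /GRing.scale /= addrC [X in X + _]mulrC.
Qed.

Lemma is_derive_exp f x df n : is_derive x 1 f df ->
  is_derive x 1 (fun t => f t ^+ n) (n%:R * f x ^+ n.-1 * df).
Proof.
move=> fd; have := is_deriveX n fd; congr is_derive.
by apply/funext => t; rewrite fctE.
Qed.

Lemma is_derive_comp f g x df dg : is_derive (g x) 1 f df ->
  is_derive x 1 g dg -> is_derive x 1 (fun t => f (g t)) (df * dg).
Proof. exact: is_derive1_comp. Qed.

Lemma is_derive_continuous f x df : is_derive x 1 f df -> {for x, continuous f}.
Proof. by case=> /derivable1_diffP /differentiable_continuous. Qed.

(** Mean value theorem for g - f. Only continuity is asked at the endpoints, which suits limit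
    equations that hold on the open half-line. *)
Lemma derivative_le f g (df dg : R -> R) (a b : R) : a <= b ->
  {within `[a, b], continuous f} -> {within `[a, b], continuous g} ->
  (forall t, a < t < b -> is_derive t 1 f (df t)) ->
  (forall t, a < t < b -> is_derive t 1 g (dg t)) ->
  (forall t, a < t < b -> df t <= dg t) ->
  f b - f a <= g b - g a.
Proof.
rewrite le_eqVlt => /predU1P[->|ab] cf cg fd gd le_d; first by rewrite !subrr.
have [||c] := @MVT _ (g \- f) (dg \- df) _ _ ab.
- move=> t; rewrite in_itv /= => tab.
  by apply: is_derive_sub; [exact: gd|exact: fd].
- by move=> t; apply: cvgB; [exact: cg|exact: cf].
rewrite in_itv /= => /le_d dc gf.
have : 0 <= (dg c - df c) * (b - a) by rewrite mulr_ge0 ?subr_ge0// ltW.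
by rewrite -gf; lra.
Qed.

(** Plays the role of the estimate of the norm of an integral by the integral of the norm, without
    integrating. *)
Lemma derivative_norm_le f g (df dg : R -> R) (a b : R) : a <= b ->
  (forall t, a <= t <= b -> is_derive t 1 f (df t)) ->
  (forall t, a <= t <= b -> is_derive t 1 g (dg t)) ->
  (forall t, a <= t <= b -> `|df t| <= dg t) ->
  `|f b - f a| <= g b - g a.
Proof.
move=> ab fd gd le_d.
have cf : {within `[a, b], continuous f}.
  apply: continuous_in_subspaceT => t; rewrite inE /= in_itv /= => /fd.
  exact: is_derive_continuous.
have cg : {within `[a, b], continuous g}.
  apply: continuous_in_subspaceT => t; rewrite inE /= in_itv /= => /gd.
  exact: is_derive_continuous.
have sub t : a < t < b -> a <= t <= b by case/andP=> /ltW-> /ltW->.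
have H1 : f b - f a <= g b - g a.
  apply: (derivative_le ab cf cg) => t /sub tab; [exact: fd|exact: gd|].
  exact: le_trans (ler_norm _) (le_d _ tab).
have H2 : (- f) b - (- f) a <= g b - g a.
  apply: (@derivative_le _ _ (fun t => - df t) _ _ _ ab _ cg) => [t|t /sub tab|t /sub tab|t /sub tab].
  - by apply: cvgN; exact: cf.
  - by apply: is_derive_opp; exact: fd.
  - exact: gd.
  - by rewrite (le_trans (ler_norm _))// normrN le_d.
move: H2; rewrite !opprfctE => H2.
by rewrite ler_norml; apply/andP; split; lra.
Qed.

Lemma is_derive_affine_approx f x d : is_derive x 1 f d -> forall e, 0 < e ->
  \forall s \near 0^'+, `|f (x + s) - f x - s * d| <= e * s.
Proof.
case=> fx fd e e0.
have : (fun h => h^-1 *: ((f \o shift x) (h *: (1 : R)) - f x)) h @[h --> (0:R)^'] --> d.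
  by rewrite -fd; exact: fx.
move=> /cvgrPdist_le/(_ e e0) H.
have {}H : \forall h \near (0:R)^'+,
    `|d - h^-1 *: ((f \o shift x) (h *: (1:R)) - f x)| <= e.
  move: H; rewrite !near_withinE; apply: filterS => h H h0.
  by apply: H; rewrite gt_eqF.
near=> s.
have s0 : 0 < s by near: s; exact: nbhs_right_gt.
have : `|d - s^-1 *: ((f \o shift x) (s *: (1:R)) - f x)| <= e by near: s.
rewrite /= /GRing.scale /= mulr1 (addrC s) => He.
have -> : f (x + s) - f x - s * d = - (s * (d - s^-1 * (f (x + s) - f x))).
  by rewrite mulrBr mulrA divff ?gt_eqF// mul1r opprB.
by rewrite normrN normrM gtr0_norm// mulrC ler_pM2r.
Unshelve. all: by end_near. Qed.

End calculus.

Section tanh.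
Context {R : realType}.
Implicit Types x y : R.

Lemma tanh_den_gt0 x : 0 < expR x + expR (- x).
Proof. by rewrite addr_gt0 ?expR_gt0. Qed.

Lemma normr_tanh_le1 x : `|tanh x| <= 1.
Proof.
have d0 := tanh_den_gt0 x; have e0 := expR_gt0 x; have e1 := expR_gt0 (- x).
rewrite /tanh normrM normfV (gtr0_norm d0) ler_pdivrMr// mul1r ler_norml.
by apply/andP; split; lra.
Qed.

Lemma is_derive_tanh x : is_derive x 1 (@tanh R) (1 - tanh x ^+ 2).
Proof.
have d0 := tanh_den_gt0 x.
have dN : is_derive x 1 (fun y : R => expR (- y)) (expR (- x) * - 1).
  by apply: is_derive_comp; apply: is_derive_opp; exact: is_derive_id.
have dE := is_derive_expR x.
have dV := @is_deriveV R (fun t => expR t + expR (- t)) x _ _ (lt0r_neq0 d0) (is_derive_add dE dN).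
apply: (is_derive_eq (is_derive_mul (is_derive_sub dE dN) dV)).
rewrite /tanh /GRing.scale /=; field; exact: lt0r_neq0.
Qed.

(** The derivative 1 - tanh^2 lies in [0, 1]. *)
Lemma tanh_lipschitz x y : `|tanh x - tanh y| <= `|x - y|.
Proof.
wlog yx : x y / y <= x.
  by move=> H; case: (leP y x) => [/H//|/ltW/H]; rewrite distrC [leRHS]distrC.
rewrite [leRHS]ger0_norm ?subr_ge0//.
apply: (@derivative_norm_le _ _ id _ (fun=> 1) _ _ yx) => t _.
- exact: is_derive_tanh.
- have := normr_tanh_le1 t; rewrite ler_norml => /andP[t1 t2].
  by rewrite ler_norml; apply/andP; split; nra.
Qed.

End tanh.

                                                             

(** * Global solutions of Lipschitz differential systems *)

Section ode.
Context {R : realType}.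

Lemma continuous_max_cst (c : R) : continuous (fun t : R => Num.max t c).
Proof.
by move=> t; apply: (@continuous_max R R (fun t => t) (cst c)); [exact: cvg_id|exact: cvg_cst].
Qed.

(** Integrating from -2 makes 0 an interior point, so that the derivative at 0 is two-sided. *)
Lemma continuous_primitive (g : R -> R) : continuous g ->
  exists G : R -> R, [/\ G 0 = 0, continuous G &
    forall t : R, 0 <= t -> is_derive t 1 G (g t)].
Proof.
move=> cg.
pose F (y : R) := (\int[lebesgue_measure]_(t in `[-2, y]) g t)%R.
have dF (t : R) : -2 < t -> is_derive t 1 F (g t).
  move=> t2.
  have int_g : lebesgue_measure.-integrable `[-2, t + 1] (EFin \o g).
    apply: continuous_compact_integrable; first exact: segment_compact.
    exact: continuous_subspaceT.
  have [|dF FE] := @continuous_FTC1_closed R g (-2) t (t + 1) _ int_g t2 (cg t).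
    by rewrite ltrDl.
  by apply: DeriveDef; rewrite -?derive1E.
(* Freezing the argument at -1 gives continuity on the whole line and changes nothing near the
   half-line t >= 0. *)
exists (fun t => F (Num.max t (-1)) - F 0); split.
- by rewrite max_l ?subrr// lerN10.
- move=> t; apply: cvgB; last exact: cvg_cst.
  have cF : {for Num.max t (-1), continuous F}.
    apply: is_derive_continuous; apply: dF.
    by rewrite lt_max; apply/orP; right; lra.
  exact: (continuous_cvg _ cF (@continuous_max_cst (-1) t)).
- move=> t t0.
  have : is_derive t 1 (fun t => F t - F 0) (g t).
    rewrite -[g t]subr0; apply: is_derive_sub.
    by apply: dF; lra.
  apply: near_eq_is_derive; near=> s.
  rewrite max_l//; apply: ltW; near: s.
  by apply: lt_nbhsr; lra.
Unshelve. all: by end_near. Qed.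

(** The intervals of centre [u n] and radius 2 C / 2^n are nested. The supremum of their left ends
    lies in all of them, which gives the limit and the rate together. *)
Lemma geometric_increments_cvg (u : nat -> R) (C : R) :
  (forall n, `|u n.+1 - u n| <= C * 2^-1 ^+ n) ->
  exists l, forall n, `|u n - l| <= 2 * C * 2^-1 ^+ n.
Proof.
move=> du.
pose v n := u n - 2 * C * 2^-1 ^+ n; pose w n := u n + 2 * C * 2^-1 ^+ n.
have C0 : 0 <= C by have := le_trans (normr_ge0 _) (du 0%N); rewrite mulr1.
have vw n : v n <= w n.
  rewrite /v /w lerD2l (@le_trans _ _ 0) ?oppr_le0 ?mulr_ge0//.
have vS n : v n <= v n.+1.
  by have := du n; rewrite /v exprS ler_norml => /andP[? ?]; lra.
have wS n : w n.+1 <= w n.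
  by have := du n; rewrite /w exprS ler_norml => /andP[? ?]; lra.
have v_nd : {homo v : m n / (m <= n)%N >-> m <= n}.
  by apply: homo_leq => //; exact: le_trans.
have w_ni : {homo w : m n / (m <= n)%N >-> n <= m}.
  by apply: homo_leq => [//|x y z yx zy|//]; exact: le_trans zy yx.
have vwmn m n : v m <= w n.
  apply: (le_trans (v_nd _ _ (leq_maxl m n))).
  by apply: (le_trans (vw _)); apply: w_ni; exact: leq_maxr.
exists (sup (range v)) => n.
have supv : v n <= sup (range v).
  apply: ub_le_sup; last by exists n.
  by exists (w 0%N) => _ [m _ <-].
have supw : sup (range v) <= w n.
  by apply: ge_sup; [exists (v 0%N); exists 0%N|move=> _ [m _ <-]].
by rewrite ler_norml; move: supv supw; rewrite /v /w => ? ?; apply/andP; split; lra.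
Qed.

End ode.

Section picard.
Context {R : realType} (n : nat) (F : ('I_n -> R) -> 'I_n -> R) (L : R).
Hypothesis L_ge0 : 0 <= L.
Hypothesis F_lip : forall x y i, `|F x i - F y i| <= L * \sum_j `|x j - y j|.

Lemma lipschitz_continuous_comp (x : 'I_n -> R -> R) i :
  (forall j, continuous (x j)) -> continuous (fun t => F (x ^~ t) i).
Proof.
move=> cx t; apply/cvgrPdist_le => e e0.
have cs : L * (\sum_j `|x j t - x j s|) @[s --> t] --> L * (\sum_j `|x j t - x j t|).
  apply: cvgM; first exact: cvg_cst.
  apply: cvg_big => [|j _]; [exact: add_continuous|apply: cvg_norm]; apply: cvgB; [exact: cvg_cst|exact: cx].
have S0 : L * (\sum_j `|x j t - x j t|) = 0.
  by rewrite big1 ?mulr0// => j _; rewrite subrr normr0.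
rewrite {}S0 in cs; move/cvgrPdist_le : cs => /(_ e e0); apply: filterS => s.
rewrite sub0r normrN ger0_norm; last by rewrite mulr_ge0 ?sumr_ge0.
exact: le_trans (F_lip _ _ _).
Qed.

(** The first term makes the Picard map a contraction by 1/2 for the norm weighted by e^(-kappa t).
    The added 1 gives t <= e^(kappa t), used for the first increment. *)
Let kappa : R := 2 * L * n%:R + 1.
Let kappa_ge1 : 1 <= kappa. Proof. by rewrite lerDr mulr_ge0 ?mulr_ge0. Qed.

                                                                          
                       
(** The derivative of z - w is at most L n C e^(kappa s), whose primitive is at most (L n / kappa) C
    e^(kappa t), and L n / kappa <= 1/2. *)
Lemma picard_contraction (x y z w : 'I_n -> R -> R) (C : R) : 0 <= C ->
  (forall i, z i 0 = w i 0) ->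
  (forall t : R, 0 <= t -> forall i, is_derive t 1 (z i) (F (x ^~ t) i)) ->
  (forall t : R, 0 <= t -> forall i, is_derive t 1 (w i) (F (y ^~ t) i)) ->
  (forall t : R, 0 <= t -> forall i, `|x i t - y i t| <= C * expR (kappa * t)) ->
  forall t : R, 0 <= t -> forall i, `|z i t - w i t| <= 2^-1 * C * expR (kappa * t).
Proof.
move=> C0 zw0 dz dw xy t t0 i.
have dE (s : R) : is_derive s 1 (fun t => 2^-1 * C * expR (kappa * t))
    (2^-1 * C * (kappa * expR (kappa * s))).
  have dl : is_derive s 1 (fun t => kappa * t) (0 * s + kappa * 1).
    exact: is_derive_mul.
  have dEk := is_derive_mul (is_derive_cst (2^-1 * C) s 1)
    (is_derive_comp (is_derive_expR (kappa * s)) dl).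
  by apply: (is_derive_eq dEk); rewrite /cst /=; ring.
have := @derivative_norm_le _ (fun t => z i t - w i t) _
  (fun s => F (x ^~ s) i - F (y ^~ s) i) _ _ _ t0
  (fun s sI => is_derive_sub (dz s (proj1 (andP sI)) i) (dw s (proj1 (andP sI)) i))
  (fun s _ => dE s).
rewrite zw0 subrr subr0 => H; apply: le_trans (H _) _ => [s /andP[s0 _]|]; last first.
  by rewrite gerBl mulr_ge0 ?mulr_ge0 ?expR_ge0.
apply: le_trans (F_lip _ _ _) _.
have : \sum_j `|x j s - y j s| <= \sum_(j < n) C * expR (kappa * s).
  by apply: ler_sum => j _; exact: xy.
rewrite sumr_const card_ord -[_ *+ n]mulr_natr => /(ler_wpM2l L_ge0) /le_trans; apply.
have E0 : 0 <= C * expR (kappa * s) by rewrite mulr_ge0 ?expR_ge0.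
by rewrite /kappa; lra.
Qed.

(** Picard iterates converge geometrically in the weighted norm, with no restriction on the time
    interval. The limit is a fixed point of the Picard map on the half-line. *)
Lemma global_ode_solution (init : 'I_n -> R) : exists z : 'I_n -> R -> R,
  [/\ forall i, z i 0 = init i, forall i, continuous (z i) &
      forall t : R, 0 <= t -> forall i, is_derive t 1 (z i) (F (z ^~ t) i)].
Proof.
have /choice[prim primP] : forall g : R -> R, exists G : R -> R, continuous g ->
    [/\ G 0 = 0, continuous G & forall t : R, 0 <= t -> is_derive t 1 G (g t)].
  move=> g; have [/continuous_primitive[G GP]|gN] := pselect (continuous g).
    by exists G.
  by exists 0.
pose step (x : 'I_n -> R -> R) i t := init i + prim (fun s => F (x ^~ s) i) t.
have stepP x : (forall i, continuous (x i)) -> forall i,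
    [/\ step x i 0 = init i, continuous (step x i) &
        forall t : R, 0 <= t -> is_derive t 1 (step x i) (F (x ^~ t) i)].
  move=> cx i; have [p0 cp dp] := primP _ (lipschitz_continuous_comp (i := i) cx).
  split; first by rewrite /step p0 addr0.
    by move=> t; apply: cvgD; [exact: cvg_cst|exact: cp].
  move=> t t0; rewrite -[F _ _]add0r; apply: is_derive_add.
  exact: dp.
pose xs m := iter m step (fun i _ => init i).
have cxs m : forall i, continuous (xs m i).
  by elim: m => [i t|m IH i]; [exact: cvg_cst|case: (stepP _ IH i)].
have xs0 m i : xs m i 0 = init i.
  by case: m => [//|m]; case: (stepP _ (cxs m) i).
have dxs m (t : R) : 0 <= t -> forall i, is_derive t 1 (xs m.+1 i) (F (xs m ^~ t) i).
  by move=> t0 i; case: (stepP _ (cxs m) i) => _ _; exact.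
pose C := \sum_i `|F init i|.
have C0 : 0 <= C by exact: sumr_ge0.
have incr m (t : R) : 0 <= t -> forall i,
    `|xs m.+1 i t - xs m i t| <= C * expR (kappa * t) * 2^-1 ^+ m.
  elim: m t => [|m IH] t t0 i.
    rewrite expr0 mulr1.
    have dC (s : R) : is_derive s 1 (fun t => C * t) (0 * s + C * 1).
      exact: is_derive_mul.
    have := @derivative_norm_le _ _ _ _ _ _ _ t0
      (fun s sI => dxs 0%N s (proj1 (andP sI)) i) (fun s _ => dC s).
    rewrite xs0 mulr0 subr0 => H; apply: le_trans (H _) _ => [s _|].
      by rewrite mul0r add0r mulr1 /C (bigD1 i)//= lerDl sumr_ge0.
    apply: ler_wpM2l => //; apply: (@le_trans _ _ (1 + kappa * t)); last exact: expR_ge1Dx.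
    by rewrite ler_wpDl// ler_peMl.
  have := @picard_contraction (xs m.+1) (xs m) (xs m.+2) (xs m.+1) (C * 2^-1 ^+ m).
  rewrite exprS => H; apply: le_trans (H _ _ (dxs m.+1) (dxs m) _ _ t0 i) _.
  - by rewrite mulr_ge0 ?exprn_ge0.
  - by move=> j; rewrite !xs0.
  - by move=> s s0 j; rewrite mulrAC; exact: IH.
  - by rewrite le_eqVlt; apply/orP; left; apply/eqP; ring.
have /choice[x0 x0P] : forall i, exists xi : R -> R, forall t : R, 0 <= t -> forall m,
    `|xs m i t - xi t| <= 2 * (C * expR (kappa * t)) * 2^-1 ^+ m.
  move=> i; have /choice[xi xiP] : forall t : R, exists l : R, 0 <= t -> forall m,
      `|xs m i t - l| <= 2 * (C * expR (kappa * t)) * 2^-1 ^+ m.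
    move=> t; have [t0|t0] := leP 0 t; last by exists 0.
    by have [l lP] := geometric_increments_cvg (fun m => incr m t t0 i); exists l.
  by exists xi.
(* The iterates are controlled for t >= 0 only; freezing the limit at 0 makes it continuous on the
   whole line, as the primitive requires. *)
pose x i t := x0 i (Num.max t 0).
have small (M : R) : forall e, 0 < e -> exists m : nat, M * 2^-1 ^+ m <= e.
  move=> e e0; have : geometric M (2^-1 : R) k @[k --> \oo] --> 0.
    by apply: cvg_geometric; rewrite ger0_norm ?invf_lt1 ?ltr1n.
  move=> /cvgrPdist_le/(_ e e0)[m _ /(_ m (leqnn m))].
  by rewrite /= sub0r normrN => Hm; exists m; exact: le_trans (ler_norm _) Hm.
have cx i : continuous (x i).
  move=> t; apply/cvgrPdist_le => e e0.
  set t' := Num.max t 0.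
  have t'0 : 0 <= t' by rewrite le_max lexx orbT.
  have [m mP] := small (2 * (C * expR (kappa * (t' + 1)))) (e / 3) ltac:(lra).
  have cm : xs m i (Num.max s 0) @[s --> t] --> xs m i t'.
    exact: (continuous_cvg _ (@cxs m i t') (@continuous_max_cst _ 0 t)).
  have apx (s : R) : 0 <= s -> s <= t' + 1 -> `|xs m i s - x0 i s| <= e / 3.
    move=> s0 st; apply: le_trans (x0P i s s0 m) _; apply: le_trans mP.
    apply: ler_wpM2r; first exact: exprn_ge0.
    apply: ler_wpM2l => //; apply: ler_wpM2l => //.
    by rewrite ler_expR ler_pM2l// (lt_le_trans ltr01).
  near=> s.
  have s1 : Num.max s 0 <= t' + 1.
    rewrite ge_max; apply/andP; split; last by lra.
    rewrite (@le_trans _ _ (t + 1)) ?lerD2r ?le_max ?lexx//.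
    apply: ltW; near: s; apply: lt_nbhsl; lra.
  have s0 : 0 <= Num.max s 0 by rewrite le_max lexx orbT.
  have H1 := apx _ s0 s1.
  have H2 := apx t' t'0 ltac:(lra).
  have H3 : `|xs m i t' - xs m i (Num.max s 0)| <= e / 3.
    by near: s; move/cvgrPdist_le : cm => /(_ (e / 3) ltac:(lra)).
  rewrite /x -/t'; move: H1 H2 H3; rewrite !ler_norml => /andP[? ?] /andP[? ?] /andP[? ?].
  by apply/andP; split; lra.
(* One more Picard step yields a differentiable function; being close to the same iterates as x, it
   coincides with x for t >= 0. *)
pose z := step x.
have zP := stepP x cx.
have zx (t : R) i : 0 <= t -> z i t = x i t.
  move=> t0.
  have xE (s : R) j : 0 <= s -> x j s = x0 j s by move=> s0; rewrite /x max_l.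
  have zxs m : `|xs m.+1 i t - z i t| <= 2 * C * expR (kappa * t) * 2^-1 ^+ m.
    have := @picard_contraction (xs m) x (xs m.+1) z (2 * C * 2^-1 ^+ m).
    move=> H; apply: le_trans (H _ _ (dxs m) _ _ _ t0 i) _.
    - by rewrite mulr_ge0 ?mulr_ge0 ?exprn_ge0.
    - by move=> j; rewrite xs0; case: (zP j).
    - by move=> s s0 j; case: (zP j) => _ _; exact.
    - by move=> s s0 j; rewrite xE// (le_trans (x0P j s s0 m))// le_eqVlt; apply/orP; left; apply/eqP; ring.
    - have : 0 <= C * expR (kappa * t) * 2^-1 ^+ m.
        by rewrite mulr_ge0 ?exprn_ge0// mulr_ge0 ?expR_ge0.
      by lra.
  apply/eqP; rewrite -subr_eq0 -normr_le0; apply/ler_addgt0Pr => e e0; rewrite add0r.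
  have [m mP] := small (4 * C * expR (kappa * t)) e e0.
  have H1 := zxs m; have H2 := x0P i t t0 m.+1; rewrite exprS in H2.
  rewrite xE//; move: H1 H2 mP; rewrite !ler_norml => /andP[? ?] /andP[? ?] ?.
  have : 0 <= C * expR (kappa * t) * 2^-1 ^+ m.
    by rewrite mulr_ge0 ?exprn_ge0// mulr_ge0 ?expR_ge0.
  by move=> ?; apply/andP; split; lra.
exists z; split.
- by move=> i; case: (zP i).
- by move=> i; case: (zP i).
- move=> t t0 i; rewrite (_ : z ^~ t = x ^~ t); last by apply/funext => j; rewrite zx.
  by case: (zP i) => _ _; exact.
Unshelve. all: by end_near. Qed.
End picard.

                                           

(** * From the generator to the semigroup *)

(** Consider the times s in [0, b] where phi 0 - c s <= phi s. Since phi cannot jump down when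
    approached from the left, their supremum is one of them; the right-hand hypothesis would carry
    the bound past a supremum smaller than b. *)
Lemma dini_decrease_bound {R : realType} (phi : R -> R) (b c : R) : 0 <= b -> 0 <= c ->
  (forall s : R, 0 <= s < b -> \forall u \near 0^'+, phi s - c * u <= phi (s + u)) ->
  (forall s : R, 0 < s <= b -> forall e : R, 0 < e ->
     \forall u \near 0^'+, phi (s - u) - e <= phi s) ->
  phi 0 - c * b <= phi b.
Proof.
move=> b0 c0 phir phil.
pose A := [set s : R | 0 <= s <= b /\ phi 0 - c * s <= phi s].
have A0 : A 0 by split; [rewrite lexx|rewrite mulr0 subr0].
have ubA : has_ubound A by exists b => s [/andP[]].
have supb : sup A <= b by apply: ge_sup; [exists 0|move=> s [/andP[]]].
have sup0 : 0 <= sup A by exact: ub_le_sup.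
have Asup : A (sup A).
  split; first by rewrite sup0 supb.
  have [->|sup_neq0] := eqVneq (sup A) 0; first by rewrite mulr0 subr0.
  have {}sup0 : 0 < sup A by rewrite lt_neqAle eq_sym sup_neq0.
  rewrite -lerBrDr; apply/ler_addgt0Pr => e e0.
  have [|d /= d0 dP] := phil (sup A) _ e e0; first by rewrite sup0.
  have [s As ds] := sup_adherent d0 (conj (ex_intro _ _ A0) ubA).
  have {}ds : sup A - d < s by [].
  have sle : s <= sup A by exact: ub_le_sup.
  have [_ sP] := As.
  move: sle; rewrite le_eqVlt => /predU1P[<-|slt]; first by lra.
  have := dP (sup A - s); rewrite /ball_ /= sub0r normrN gtr0_norm ?subr_gt0//.
  move=> /(_ ltac:(lra) slt); rewrite subKr => Hs.
  have : 0 <= c * (sup A - s) by rewrite mulr_ge0// subr_ge0 ltW.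
  by lra.
move: supb; rewrite le_eqVlt => /predU1P[supb|supb].
  by case: Asup; rewrite supb.
have [_ supP] := Asup.
have [|d /= d0 dP] := phir (sup A); first by rewrite sup0.
pose u := Num.min (d / 2) ((b - sup A) / 2).
have u0 : 0 < u by rewrite lt_min; apply/andP; split; lra.
have ud : u <= d / 2 by rewrite ge_min lexx.
have ub : u <= (b - sup A) / 2 by rewrite ge_min lexx orbT.
have := dP u; rewrite /ball_ /= sub0r normrN gtr0_norm// => /(_ ltac:(lra) u0) Hu.
have : sup A + u <= sup A.
  apply: ub_le_sup => //; split; first by apply/andP; split; lra.
  by lra.
by lra.
Qed.

Section disintegration.
Context {R : realType} {d d' : measure_display}.
Context {S : measurableType d} {T : measurableType d'}.
Variables (nu : {measure set S -> \bar R}) (mu : {measure set T -> \bar R}).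
Variables (K : T -> {measure set S -> \bar R}) (D : set T).
Hypothesis mD : measurable D.
Hypothesis mK : forall A, measurable A -> measurable_fun D (fun w => K w A : \bar R).
Hypothesis nuE : forall A, measurable A -> nu A = (\int[mu]_(w in D) K w A)%E.
Local Open Scope ereal_scope.
Import HBNNSimple.

Lemma disintegration_nnsfun (h : {nnsfun S >-> R}) :
  \int[nu]_x (h x)%:E = \int[mu]_(w in D) (\int[K w]_x (h x)%:E).
Proof.
have mh r : measurable (h @^-1` [set r]) by exact: measurable_sfunP.
rewrite integralT_nnsfun sintegralE.
under eq_integral do rewrite integralT_nnsfun sintegralE.
rewrite ge0_integral_fsum//; last 2 first.
  by move=> r; apply: measurable_funeM; exact: mK.
  by move=> r w _; exact: nnsfun_mulemu_ge0.
apply: eq_fsbigr => r; rewrite inE => -[x _ hx].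
rewrite nuE// ge0_integralZl//; first exact: mK.
by rewrite lee_fin -hx.
Qed.

(** Simple functions, then monotone convergence. It serves three times: for Chapman-Kolmogorov, for
    the Markov property on an event [D], and for restricting a measure (Dirac kernels). *)
Lemma ge0_disintegration (f : S -> \bar R) : (forall x, 0 <= f x) ->
  measurable_fun setT f ->
  \int[nu]_x f x = \int[mu]_(w in D) (\int[K w]_x f x).
Proof.
move=> f0 mf.
pose f_ := nnsfun_approx measurableT mf.
have mf_ n : measurable_fun setT (EFin \o f_ n) by exact/measurable_EFinP.
have f_0 n x : 0 <= (f_ n x)%:E by rewrite lee_fin.
have f_nd x : {homo (fun n => (f_ n x)%:E) : m n / (m <= n)%N >-> m <= n}.
  by move=> m n mn; rewrite lee_fin; exact/lefP/nd_nnsfun_approx.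
have mono (m : {measure set S -> \bar R}) :
    \int[m]_x (f_ n x)%:E @[n --> \oo] --> \int[m]_x f x.
  rewrite (_ : \int[m]_x f x = \int[m]_x limn (fun n => (f_ n x)%:E)).
    by apply: cvg_monotone_convergence => // x _; exact: f_nd.
  by apply: eq_integral => x _; apply/esym/cvg_lim => //; exact: cvg_nnsfun_approx.
have inner n : measurable_fun D (fun w => \int[K w]_x (f_ n x)%:E).
  under eq_fun do rewrite integralT_nnsfun sintegralE.
  apply: emeasurable_fun_fsum => // r; apply: measurable_funeM; apply: mK.
  exact: measurable_sfunP.
have lim1 : \int[mu]_(w in D) (\int[K w]_x (f_ n x)%:E) @[n --> \oo] -->
    \int[nu]_x f x.
  by have := mono nu; under eq_fun do rewrite disintegration_nnsfun.
have lim2 : \int[mu]_(w in D) (\int[K w]_x (f_ n x)%:E) @[n --> \oo] -->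
    \int[mu]_(w in D) (\int[K w]_x f x).
  rewrite (_ : \int[mu]_(w in D) (\int[K w]_x f x) =
      \int[mu]_(w in D) limn (fun n => \int[K w]_x (f_ n x)%:E)).
    apply: cvg_monotone_convergence => //.
    - by move=> n w _; apply: integral_ge0 => x _; exact: f_0.
    - move=> w _ m n mn; apply: ge0_le_integral => //; [exact: mf_|exact: mf_|].
      by move=> x _; exact: (f_nd x _ _ mn).
  by apply: eq_integral => w _; apply/esym/cvg_lim => //; exact: mono.
by rewrite -(cvg_lim _ lim1)//; exact: cvg_lim.
Qed.

End disintegration.

Section bounded_integrals.
Context {R : realType} {d : measure_display} {S : measurableType d}.

Definition bounded_measurable (f : S -> R) :=
  measurable_fun setT f /\ exists M : R, forall x, `|f x| <= M.

Lemma bounded_measurable_cst (c : R) : bounded_measurable (fun=> c).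
Proof. by split; [exact: measurable_cst|exists `|c|]. Qed.

Lemma bounded_measurableD (f g : S -> R) : bounded_measurable f ->
  bounded_measurable g -> bounded_measurable (fun x => f x + g x).
Proof.
move=> [mf [M fM]] [mg [M' gM]]; split; first exact: measurable_funD.
by exists (M + M') => x; rewrite (le_trans (ler_normD _ _))// lerD.
Qed.

Lemma bounded_measurableZ (c : R) (f : S -> R) : bounded_measurable f ->
  bounded_measurable (fun x => c * f x).
Proof.
move=> [mf [M fM]]; split; first exact: measurable_funM.
by exists (`|c| * M) => x; rewrite normrM ler_wpM2l.
Qed.

Variable mu : {measure set S -> \bar R}.
Hypothesis mu1 : mu setT = 1%E.

Lemma bounded_measurable_integrable (f : S -> R) :
  bounded_measurable f -> mu.-integrable setT (EFin \o f).
Proof.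
move=> [mf [M fM]]; apply: measurable_bounded_integrable => //.
  by rewrite mu1 ltry.
by exists M; split; [exact: num_real|move=> m /ltW Mm x _; exact: le_trans Mm].
Qed.

Lemma Rintegral_bounded_cst (c : R) : \int[mu]_x c = c.
Proof. by rewrite Rintegral_cst// mu1 mulr1. Qed.

Lemma Rintegral_boundedD (f g : S -> R) : bounded_measurable f ->
  bounded_measurable g -> \int[mu]_x (f x + g x) = \int[mu]_x f x + \int[mu]_x g x.
Proof.
by move=> bf bg; rewrite RintegralD//; exact: bounded_measurable_integrable.
Qed.

Lemma Rintegral_boundedZ (c : R) (f : S -> R) : bounded_measurable f ->
  \int[mu]_x (c * f x) = c * \int[mu]_x f x.
Proof. by move=> bf; rewrite RintegralZl//; exact: bounded_measurable_integrable. Qed.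

Lemma le_Rintegral_bounded (f g : S -> R) : bounded_measurable f ->
  bounded_measurable g -> (forall x, f x <= g x) ->
  \int[mu]_x f x <= \int[mu]_x g x.
Proof.
move=> bf bg fg; apply: le_Rintegral => //; exact: bounded_measurable_integrable.
Qed.

Lemma EFin_Rintegral_bounded (f : S -> R) : bounded_measurable f ->
  (\int[mu]_x f x)%:E = (\int[mu]_x (f x)%:E)%E.
Proof.
move=> bf; rewrite /Rintegral fineK//; apply: integrable_fin_num => //.
exact: bounded_measurable_integrable.
Qed.

End bounded_integrals.

Section semigroup_lower_bound.
Context {R : realType} {d : measure_display} {S : measurableType d}.
Variables (P : R -> R.-pker S ~> S) (D : set (S -> R)) (L : (S -> R) -> S -> R).
Hypothesis P_semigroup : transition_semigroup P.
Hypothesis P_generator : infinitesimal_generator P D L.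
Hypothesis D_bounded : forall f, D f -> bounded_measurable f.
Hypothesis L_bounded : forall f, D f -> exists M : R, forall x, `|L f x| <= M.

Lemma pker1 t x : P t x setT = 1%E. Proof. exact: prob_kernel. Qed.

(** The difference quotient is uniformly within 1 of the bounded function L f, so P_s f - f is O(s)
    uniformly. *)
Lemma semigroup_continuous_at0 f : D f -> forall e : R, 0 < e ->
  \forall s \near 0^'+, forall x, `|\int[P s x]_y f y - f x| <= e.
Proof.
move=> Df e e0; have [M LM] := L_bounded Df.
near=> s => x.
have s0 : 0 < s by near: s; exact: nbhs_right_gt.
have : `|((\int[P s x]_y f y) - f x) / s - L f x| < 1.
  by move: x; near: s; exact: P_generator.
have := LM x.
have : s * (`|M| + 1) <= e.
  rewrite -ler_pdivlMr ?ltr_wpDl//; near: s; apply: nbhs_right_le.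
  by rewrite divr_gt0// ltr_wpDl.
move: (\int[P s x]_y f y) => I sM LMx.
rewrite -(ltr_pM2r s0) mul1r -[X in _ * X < _]gtr0_norm// -normrM mulrBl divfK ?gt_eqF// => H.
have -> : I - f x = (I - f x - L f x * s) + L f x * s by ring.
apply: le_trans (ler_normD _ _) _; rewrite [X in _ + X <= _]normrM (gtr0_norm s0).
have : `|L f x| * s <= `|M| * s by rewrite ler_pM2r// (le_trans LMx)// ler_norm.
by lra.
Unshelve. all: by end_near. Qed.

Lemma measurable_pker_integral s f : bounded_measurable f -> (forall x, 0 <= f x) ->
  measurable_fun setT (fun x => \int[P s x]_y (f y)%:E)%E.
Proof.
move=> [mf _] f0; apply: measurable_fun_integral_kernel => [U mU|x|].
- exact: measurable_kernel.
- by rewrite lee_fin.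
- exact/measurable_EFinP.
Qed.

Lemma bounded_pker_integral s f : bounded_measurable f -> (forall x, 0 <= f x) ->
  bounded_measurable (fun x => \int[P s x]_y f y).
Proof.
move=> bf f0; split.
  apply/measurable_EFinP; apply: eq_measurable_fun (measurable_pker_integral s bf f0) => x _.
  by rewrite /= EFin_Rintegral_bounded//; exact: pker1.
have [_ [M fM]] := bf; exists M => x.
rewrite ger0_norm; last by apply: Rintegral_ge0 => y _; exact: f0.
rewrite -[leRHS](Rintegral_bounded_cst (pker1 s x)).
apply: le_Rintegral_bounded => //; [exact: pker1|exact: bounded_measurable_cst|].
by move=> y; exact: le_trans (ler_norm _) (fM y).
Qed.

Lemma chapman_kolmogorov s t x f : 0 <= s -> 0 <= t -> bounded_measurable f ->
  (forall x, 0 <= f x) ->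
  \int[P (s + t) x]_y f y = \int[P s x]_y \int[P t y]_z f z.
Proof.
move=> s0 t0 bf f0; apply/EFin_inj.
rewrite !EFin_Rintegral_bounded//; [|exact: pker1|exact: bounded_pker_integral|exact: pker1].
rewrite (@ge0_disintegration _ _ _ _ _ (P (s + t) x) (P s x) (P t) setT)//.
- by apply: eq_integral => y _; rewrite EFin_Rintegral_bounded//; exact: pker1.
- by move=> A mA; exact: measurable_kernel.
- by move=> A mA; apply: P_semigroup.2.
- by apply/measurable_EFinP; exact: bf.1.
Qed.

Lemma semigroup0 x f : bounded_measurable f -> \int[P 0 x]_y f y = f x.
Proof.
move=> [mf _]; rewrite /Rintegral (@eq_measure_integral _ _ _ _ (\d_x)).
  by rewrite integral_dirac//= ?indicE ?in_setT ?mul1r//; exact/measurable_EFinP.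
by move=> A mA _; rewrite P_semigroup.1.
Qed.

(** [g t] stands for the time derivative of [f t]. The hypotheses on time variation are one-sided
    and uniform in the state, the form that a tangent-line inequality provides. *)
Variables (f g : R -> S -> R) (T c : R).
Hypothesis c0 : 0 <= c.
Hypothesis f_ge0 : forall t x, 0 <= f t x.
Hypothesis Df : forall t, 0 <= t <= T -> D (f t).
Hypothesis Dg : forall t, 0 <= t <= T -> D (g t).
Hypothesis f_right : forall t, 0 <= t < T -> forall e : R, 0 < e ->
  \forall s \near 0^'+, forall x, f t x + s * g t x - e * s <= f (t + s) x.
Hypothesis f_left : forall t, 0 < t <= T -> forall e : R, 0 < e ->
  \forall s \near 0^'+, forall x, f (t - s) x - e <= f t x.
Hypothesis Lfg : forall t, 0 <= t <= T -> forall x, - c <= L (f t) x + g t x.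

Let bf t : 0 <= t <= T -> bounded_measurable (f t).
Proof. by move=> /Df/D_bounded. Qed.

(** P_s f_(t+s) is at least P_s f_t + s P_s g_t, hence f_t + s (L f_t + g_t), up to three errors of
    e/3 per unit time: the expansion in time, the generator, and the continuity of P_s g_t at s = 0.
    The last one is why [g t] has to lie in the domain. *)
Lemma semigroup_right_bound t : 0 <= t < T -> forall e : R, 0 < e ->
  \forall s \near 0^'+, forall x, f t x - (c + e) * s <= \int[P s x]_y f (t + s) y.
Proof.
move=> /andP[t0 tT] e e0.
have tI : 0 <= t <= T by rewrite t0 ltW.
have e3 : 0 < e / 3 by lra.
have tI' : 0 <= t < T by rewrite t0.
near=> s.
have s0 : 0 < s by near: s; exact: nbhs_right_gt.
have sT : t + s <= T.
  by rewrite -lerBrDl; near: s; apply: nbhs_right_le; rewrite subr_gt0.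
have H1 : forall y, f t y + s * g t y - e / 3 * s <= f (t + s) y.
  by near: s; exact: f_right.
have H2' : forall x, `|((\int[P s x]_y f t y) - f t x) / s - L (f t) x| < e / 3.
  by near: s; exact: P_generator (Df tI) _ e3.
have H3' : forall x, `|\int[P s x]_y g t y - g t x| <= e / 3.
  by near: s; exact: semigroup_continuous_at0 (Dg tI) _ e3.
move=> x; have H2 := H2' x; have H3 := H3' x.
have bg : bounded_measurable (g t) by exact: D_bounded (Dg tI).
have : \int[P s x]_y (f t y + s * g t y - e / 3 * s) <= \int[P s x]_y f (t + s) y.
  apply: le_Rintegral_bounded H1; first exact: pker1; last first.
    by apply: bf; rewrite addr_ge0// ltW.
  apply: bounded_measurableD (bounded_measurable_cst _).
  by apply: bounded_measurableD (bounded_measurableZ _ bg); exact: bf.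
have p1 := pker1 s x.
rewrite (Rintegral_boundedD p1 (bounded_measurableD (bf tI) (bounded_measurableZ _ bg))
  (bounded_measurable_cst _)).
rewrite (Rintegral_boundedD p1 (bf tI) (bounded_measurableZ _ bg)) (Rintegral_boundedZ p1)//.
rewrite (Rintegral_bounded_cst p1).
move: H2 H3 (Lfg tI x); move: (\int[P s x]_y f t y) (\int[P s x]_y g t y) => I J.
rewrite -(ltr_pM2r s0) -[X in _ * X < _]gtr0_norm// -normrM mulrBl divfK ?gt_eqF//.
rewrite ltr_norml ler_norml => /andP[H2 _] /andP[H3 _] H4; apply: le_trans.
have H3'' : s * (- (e / 3) + g t x) <= s * J by rewrite ler_pM2l//; lra.
have H4' : - c * s <= (L (f t) x + g t x) * s by rewrite ler_pM2r.
by lra.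
Unshelve. all: by end_near. Qed.

Lemma semigroup_left_bound t : 0 < t <= T -> forall e : R, 0 < e ->
  \forall s \near 0^'+, forall x, f (t - s) x - e <= \int[P s x]_y f t y.
Proof.
move=> /andP[t0 tT] e e0.
have tI : 0 <= t <= T by rewrite tT ltW.
have tI' : 0 < t <= T by rewrite t0.
have e2 : 0 < e / 2 by lra.
near=> s.
have H1 : forall x, f (t - s) x - e / 2 <= f t x by near: s; exact: f_left.
have H2 : forall x, `|\int[P s x]_y f t y - f t x| <= e / 2.
  by near: s; exact: semigroup_continuous_at0 (Df tI) _ e2.
by move=> x; move: (H2 x) (H1 x); rewrite ler_norml => /andP[H3 _] H4; lra.
Unshelve. all: by end_near. Qed.

(** Along phi u = P_u f_(t+u) (x), Chapman-Kolmogorov and monotonicity of P_u turn the two preceding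
    bounds into the hypotheses of [dini_decrease_bound], with slope c + e for arbitrary e > 0. *)
Lemma semigroup_lower_bound t s x : 0 <= t -> 0 <= s -> t + s <= T ->
  f t x - c * s <= \int[P s x]_y f (t + s) y.
Proof.
move=> t0 s0 tsT.
suff H e : 0 < e -> f t x - (c + e) * s <= \int[P s x]_y f (t + s) y.
  apply/ler_addgt0Pr => e e0.
  (* The denominator s + 1 also covers s = 0. *)
  have e1 : 0 < e / (s + 1) by rewrite divr_gt0// ltr_wpDl.
  have := H _ e1.
  have : e / (s + 1) * s <= e by rewrite mulrAC ler_pdivrMr ?ltr_wpDl// ler_pM2l// lerDl.
  lra.
move=> e0.
pose phi u := \int[P u x]_y f (t + u) y.
have fI u : 0 <= u <= s -> 0 <= t + u <= T.
  by move=> /andP[u0 us]; apply/andP; split; lra.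
have -> : f t x = phi 0 by rewrite /phi addr0 semigroup0//; apply: bf; apply/andP; split; lra.
apply: (@dini_decrease_bound _ phi _ _ s0 (addr_ge0 c0 (ltW e0))).
- move=> u /andP[u0 us].
  have tuI : 0 <= t + u < T by apply/andP; split; lra.
  near=> v.
  have v0 : 0 < v by near: v; exact: nbhs_right_gt.
  have vs : u + v <= s.
    by rewrite -lerBrDl; near: v; apply: nbhs_right_le; rewrite subr_gt0.
  have bfuv : bounded_measurable (f (t + (u + v))).
    by apply: bf; apply: fI; apply/andP; split; lra.
  have bfu : bounded_measurable (f (t + u)) by apply: bf; apply/andP; split; lra.
  rewrite /phi (chapman_kolmogorov x u0 (ltW v0) bfuv)//.
  have p1 := pker1 u x.
  have <- : \int[P u x]_y (f (t + u) y - (c + e) * v) =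
      \int[P u x]_y f (t + u) y - (c + e) * v.
    rewrite (Rintegral_boundedD p1 bfu (bounded_measurable_cst _)).
    by rewrite (Rintegral_bounded_cst p1).
  apply: le_Rintegral_bounded => //.
  + exact: bounded_measurableD bfu (bounded_measurable_cst _).
  + exact: bounded_pker_integral.
  + by rewrite addrA; near: v; exact: semigroup_right_bound.
- move=> u /andP[u0 us] e' e'0.
  have tuI : 0 < t + u <= T by apply/andP; split; lra.
  near=> v.
  have v0 : 0 < v by near: v; exact: nbhs_right_gt.
  have vu : v <= u by near: v; exact: nbhs_right_le.
  have bfu : bounded_measurable (f (t + u)) by apply: bf; apply/andP; split; lra.
  have bfuv : bounded_measurable (f (t + (u - v))).
    by apply: bf; apply: fI; apply/andP; split; lra.
  have uv0 : 0 <= u - v by rewrite subr_ge0.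
  have -> : phi u = \int[P (u - v + v) x]_y f (t + u) y by rewrite subrK.
  rewrite /phi (chapman_kolmogorov x uv0 (ltW v0) bfu)//.
  have p1 := pker1 (u - v) x.
  have <- : \int[P (u - v) x]_y (f (t + (u - v)) y - e') =
      \int[P (u - v) x]_y f (t + (u - v)) y - e'.
    rewrite (Rintegral_boundedD p1 bfuv (bounded_measurable_cst _)).
    by rewrite (Rintegral_bounded_cst p1).
  apply: le_Rintegral_bounded => //.
  + exact: bounded_measurableD bfuv (bounded_measurable_cst _).
  + exact: bounded_pker_integral.
  + by rewrite addrA; near: v; exact: semigroup_left_bound.
Unshelve. all: by end_near. Qed.

End semigroup_lower_bound.

                                                  

(** * A maximal inequality for Markov processes *)

Section mrestr.
Local Open Scope ereal_scope.
Context {R : realType} {d : measure_display} {T : measurableType d}.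

                                                                   
Lemma ge0_integral_mrestr (mu : {measure set T -> \bar R}) (B : set T)
    (mB : measurable B) (f : T -> \bar R) : (forall x, 0 <= f x) ->
  measurable_fun setT f ->
  \int[mrestr mu mB]_x f x = \int[mu]_(x in B) f x.
Proof.
move=> f0 mf.
rewrite (@ge0_disintegration _ _ _ _ _ (mrestr mu mB) mu (fun w => \d_w) B)//.
- apply: eq_integral => x _; rewrite integral_dirac//.
  by rewrite diracT mul1e.
- move=> A mA; rewrite /dirac; apply/measurable_EFinP; exact: measurable_indic.
- move=> A mA; rewrite /mrestr /dirac integral_indic//.
Qed.
End mrestr.

Section markov_maximal.
Context {R : realType} {d d' : measure_display}.
Context {S : measurableType d} {T : measurableType d'}.
Variables (Q : probability T R) (X : R -> T -> S) (P : R -> R.-pker S ~> S).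
Hypothesis QX : markov_process Q X P.

Lemma measurable_marginal t : 0 <= t -> measurable_fun setT (X t).
Proof. exact: QX.1. Qed.

Lemma natural_filtration_measurable s B : natural_filtration X s B -> measurable B.
Proof.
apply: smallest_sub; first exact: sigma_algebra_measurable.
move=> _ [u [A [/andP[u0 _] mA ->]]].
by rewrite -[X in measurable X]setTI; exact: measurable_marginal.
Qed.

Lemma natural_filtration_le s t : s <= t ->
  natural_filtration X s `<=` natural_filtration X t.
Proof.
move=> st; apply: sub_sigma_algebra2 => _ [u [A [/andP[u0 us] mA ->]]].
by exists u, A; split => //; rewrite u0 (le_trans us).
Qed.

Lemma natural_filtration_preimage s (A : set S) : 0 <= s -> measurable A ->
  natural_filtration X s (X s @^-1` A).
Proof.
by move=> s0 mA; apply: sub_gen_smallest; exists s, A; rewrite s0 lexx.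
Qed.

Lemma natural_filtrationI s B C : natural_filtration X s B ->
  natural_filtration X s C -> natural_filtration X s (B `&` C).
Proof.
have sG : sigma_algebra setT (natural_filtration X s) by exact: smallest_sigma_algebra.
move=> sB sC.
have [s0 sD sU] := sG.
have -> : B `&` C = setT `\` ((setT `\` B) `|` (setT `\` C)).
  by rewrite !setTD setCU !setCK.
apply: (sD); rewrite -bigcup2E.
by apply: sU => -[|[|n]] /=; [exact: sD|exact: sD|].
Qed.

(** The Markov property on sets says that the law of X (s + t) restricted to B is a mixture of the
    kernels P t (X s w) over w in B; disintegration then passes from sets to functions. *)
Lemma markov_integral s t (B : set T) (f : S -> \bar R) : 0 <= s -> 0 <= t ->
  natural_filtration X s B -> (forall x, 0 <= f x)%E -> measurable_fun setT f ->
  (\int[Q]_(w in B) f (X (s + t) w) = \int[Q]_(w in B) \int[P t (X s w)]_x f x)%E.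
Proof.
move=> s0 t0 sB f0 mf.
have mB := natural_filtration_measurable sB.
have mXst := measurable_marginal (addr_ge0 s0 t0).
have mfX : measurable_fun setT (f \o X (s + t)) by exact: measurableT_comp.
rewrite -(@ge0_integral_mrestr _ _ _ Q B mB (f \o X (s + t)))//.
pose phi : {mfun T >-> S} := HB.pack (X (s + t)) (isMeasurableFun.Build _ _ _ _ _ mXst).
have := @ge0_integral_pushforward _ _ _ _ _ _ mXst (mrestr Q mB) setT f measurableT mf (fun x _ => f0 x).
rewrite preimage_setT => <-.
apply: (@ge0_disintegration _ _ _ _ _ (pushforward (mrestr Q mB) phi) Q (fun w => P t (X s w)) B) => //.
- move=> A mA; apply: measurable_funTS.
  by apply: (measurableT_comp (measurable_kernel (P t) A mA)); exact: measurable_marginal.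
- move=> A mA; rewrite -[LHS]/(Q (X (s + t) @^-1` A `&` B)) setIC; exact: QX.2.
by move=> w; exact: f0.
Qed.

Variables (f : R -> S -> R) (tau c : R).
Hypothesis c0 : 0 <= c.
Hypothesis f_meas : forall t, 0 <= t <= tau -> measurable_fun setT (f t).
Hypothesis f_ge0 : forall t x, 0 <= f t x.
Hypothesis f_le1 : forall t x, f t x <= 1.
Hypothesis f_lower : forall t s x, 0 <= t -> 0 <= s -> t + s <= tau ->
  f t x - c * s <= \int[P s x]_y f (t + s) y.

Let Ef B t := (\int[Q]_(w in B) (f t (X t w))%:E)%E.

Let mfX t : 0 <= t <= tau -> measurable_fun setT (fun w => (f t (X t w))%:E).
Proof.
move=> tI; apply/measurable_EFinP; apply: measurableT_comp (f_meas tI) _.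
by apply: measurable_marginal; case/andP: tI.
Qed.

(** This is the submartingale property of f t (X t) + c t, tested on an event B of the past. *)
Lemma markov_submartingale_step t s B : 0 <= t -> 0 <= s -> t + s <= tau ->
  natural_filtration X t B -> (Ef B t <= Ef B (t + s) + (c * s)%:E)%E.
Proof.
move=> t0 s0 ts tB.
have mB := natural_filtration_measurable tB.
have tI : 0 <= t <= tau by apply/andP; split; lra.
have tsI : 0 <= t + s <= tau by apply/andP; split; lra.
have mf := f_meas tsI.
have bf : bounded_measurable (f (t + s)).
  by split => //; exists 1 => x; rewrite ger0_norm.
have mI : measurable_fun setT (fun x => \int[P s x]_y (f (t + s) y)%:E)%E.
  by apply: measurable_pker_integral.
have -> : Ef B (t + s) = (\int[Q]_(w in B) \int[P s (X t w)]_x (f (t + s) x)%:E)%E.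
  apply: (@markov_integral t s B (EFin \o f (t + s))) => //.
    by move=> x; rewrite lee_fin.
  exact/measurable_EFinP.
have cs0 : 0 <= c * s by rewrite mulr_ge0.
apply: (@le_trans _ _ (\int[Q]_(w in B) (\int[P s (X t w)]_x (f (t + s) x)%:E + (c * s)%:E))%E).
  apply: ge0_le_integral => //.
  - by move=> w _; rewrite lee_fin.
  - exact: measurable_funTS (mfX tI).
  - apply: emeasurable_funD => //; apply: measurable_funTS.
    by apply: measurableT_comp mI _; exact: measurable_marginal.
  - move=> w _; rewrite -EFin_Rintegral_bounded ?pker1//.
    by rewrite -EFinD lee_fin -lerBlDr; exact: f_lower.
rewrite ge0_integralD//.
- rewrite integral_cst// leeD2l//.
  by rewrite -[leRHS]mule1 lee_wpmul2l ?lee_fin ?probability_le1.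
- by move=> w _; apply: integral_ge0 => x _; rewrite lee_fin.
- apply: measurable_funTS.
  by apply: measurableT_comp mI _; exact: measurable_marginal.
Qed.

Variable a : R.
Hypothesis a_gt0 : 0 < a.
Hypothesis a_le1 : a <= 1.

Definition above_on_grid (h : R) (n : nat) : set T :=
  [set w | forall k, (k <= n)%N -> 1 - a < f (k%:R * h) (X (k%:R * h) w)].

Let above t : set T := X t @^-1` [set x | 1 - a < f t x].

Let above_filtration t : 0 <= t <= tau -> natural_filtration X t (above t).
Proof.
move=> tI; have /andP[t0 _] := tI; apply: natural_filtration_preimage => //.
rewrite (_ : [set x | _] = f t @^-1` `]1 - a, +oo[).
  by rewrite -[X in measurable X]setTI; apply: f_meas.
by apply/seteqP; split => x /=; rewrite in_itv /= andbT.
Qed.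

Let above_gridS h n :
  above_on_grid h n.+1 = above_on_grid h n `&` above (n.+1%:R * h).
Proof.
apply/seteqP; split => [w Cw|w [Cw Aw] k].
  by split=> [k kn|]; [apply: Cw; exact: leqW|exact: Cw].
by rewrite leq_eqVlt => /predU1P[->//|]; rewrite ltnS => /Cw.
Qed.

Let above_grid0 h : above_on_grid h 0 = above (0%:R * h).
Proof.
apply/seteqP; split => [w Cw|w Aw k]; first exact: Cw.
by rewrite leqn0 => /eqP ->.
Qed.

Lemma above_on_grid_filtration h n : 0 <= h -> n%:R * h <= tau ->
  natural_filtration X (n%:R * h) (above_on_grid h n).
Proof.
move=> h0; elim: n => [|n IH] nh.
  by rewrite above_grid0; apply: above_filtration; rewrite nh mulr_ge0.
have le_nh : n%:R * h <= n.+1%:R * h by rewrite ler_wpM2r// ler_nat.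
rewrite above_gridS; apply: natural_filtrationI.
  by apply: (natural_filtration_le le_nh); apply: IH; exact: le_trans nh.
by apply: above_filtration; rewrite nh mulr_ge0.
Qed.

Let split_above t B : 0 <= t <= tau -> measurable B ->
  (Ef B t <= (1 - a)%:E * Q (B `\` above t) + Ef (B `&` above t) t)%E.
Proof.
move=> tI mB; have mA := natural_filtration_measurable (above_filtration tI).
have mBA : measurable (B `\` above t) by exact: measurableD.
have mBIA : measurable (B `&` above t) by exact: measurableI.
rewrite /Ef -[X in (integral _ X _ <= _)%E](setDUK (@subIsetl _ B (above t))).
rewrite ge0_integral_setU//; last 4 first.
- exact: measurableD.
- exact: measurable_funTS (mfX tI).
- by move=> w _; rewrite lee_fin.
- by rewrite disj_set2E setDIK.
rewrite addeC leeD2r// setDIr setDv set0U.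
rewrite -integral_cst//; apply: ge0_le_integral => //.
- by move=> w _; rewrite lee_fin.
- exact: measurable_funTS (mfX tI).
- by move=> w [_ /= Aw]; rewrite lee_fin leNgt; apply/negP.
Qed.

(** Doob's argument, stopping at the first grid time where f is at most 1 - a. The first term
    accounts for the stopped paths, the second for the survivors. The induction moves the survivors
    by one submartingale step, then splits off those that stop at the new time. *)
Lemma grid_maximal_ereal h n : 0 <= h -> n%:R * h <= tau ->
  (Ef setT 0 <= (1 - a)%:E * Q (~` above_on_grid h n) +
     Ef (above_on_grid h n) (n%:R * h) + (c * (n%:R * h))%:E)%E.
Proof.
move=> h0; elim: n => [|n IH] nh.
  have := @split_above (0%:R * h) setT _ measurableT.
  rewrite above_grid0 setTD setTI mul0r mulr0 adde0; apply; rewrite lexx /=.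
  by rewrite mul0r in nh.
have le_nh : n%:R * h <= n.+1%:R * h by rewrite ler_wpM2r// ler_nat.
have nh' := le_trans le_nh nh.
have nhI : 0 <= n%:R * h by rewrite mulr_ge0.
have nhE : n.+1%:R * h = n%:R * h + h by rewrite -[n.+1]addn1 natrD mulrDl mul1r.
have nhT : 0 <= n.+1%:R * h <= tau by rewrite nh mulr_ge0.
have Fn := above_on_grid_filtration h0 nh'.
have mC := natural_filtration_measurable Fn.
have mC' := natural_filtration_measurable (above_on_grid_filtration h0 nh).
have mA := natural_filtration_measurable (above_filtration nhT).
apply: (le_trans (IH nh')).
have step1 := markov_submartingale_step nhI h0 (eq_ind _ (fun z => z <= tau) nh _ nhE) Fn.
rewrite -nhE in step1.
have step2 := split_above nhT mC.
have -> : (Q (~` above_on_grid h n.+1) =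
    Q (~` above_on_grid h n) + Q (above_on_grid h n `\` above (n.+1%:R * h)))%E.
  rewrite -measureU//; [|exact: measurableC|exact: measurableD|]; last first.
    by apply/seteqP; split => // w [/= + []].
  congr (Q _); rewrite above_gridS setCI; apply/seteqP; split => w /=.
    case=> [Cw|Aw]; first by left.
    by have [Cw|Cw] := pselect (above_on_grid h n w); [right|left].
  by case=> [Cw|[Cw Aw]]; [left|right].
have p0 A : (0 <= (1 - a)%:E * Q A)%E by rewrite mule_ge0// lee_fin subr_ge0.
rewrite ge0_muleDr// -above_gridS in step2 *.
have -> : (c * (n.+1%:R * h))%:E = ((c * h)%:E + (c * (n%:R * h))%:E)%E.
  by rewrite -EFinD nhE; congr EFin; ring.
move: (Ef (above_on_grid h n) (n%:R * h)) (Ef (above_on_grid h n) (n.+1%:R * h))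
  (Ef (above_on_grid h n.+1) (n.+1%:R * h)) step1 step2 => E1 E2 E3 step1 step2.
rewrite !addeA leeD2r// -!addeA leeD2l// addeA.
by apply: (le_trans step1); rewrite leeD2r.
Qed.

(** Since f <= 1 on the survivors, a failure probability q satisfies E f_0 <= (1 - a) q + (1 - q) +
    c tau; solve for q. *)
Lemma grid_maximal h n : 0 <= h -> n%:R * h <= tau ->
  (Q (~` above_on_grid h n) <=
     ((1 - \int[Q]_w f 0 (X 0 w) + c * tau) / a)%:E)%E.
Proof.
move=> h0 nh.
have nhI : 0 <= n%:R * h <= tau by rewrite nh mulr_ge0.
have tau0 : 0 <= tau by case/andP: nhI => /le_trans; exact.
have mC := natural_filtration_measurable (above_on_grid_filtration h0 nh).
have mf0 : bounded_measurable (fun w => f 0 (X 0 w)).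
  split; last by exists 1 => w; rewrite ger0_norm.
  by apply/measurable_EFinP; apply: mfX; rewrite lexx.
have := grid_maximal_ereal h0 nh.
have -> : Ef setT 0 = (\int[Q]_w f 0 (X 0 w))%:E.
  by rewrite (EFin_Rintegral_bounded (@probability_setT _ _ _ Q)).
have EC : (Ef (above_on_grid h n) (n%:R * h) <= Q (above_on_grid h n))%E.
  rewrite -[leRHS]mul1e -integral_cst//; apply: ge0_le_integral => //.
  - by move=> w _; rewrite lee_fin.
  - exact: measurable_funTS (mfX nhI).
  - by move=> w _; rewrite lee_fin.
have QC := probability_setC Q mC.
move: EC; rewrite QC.
have /fineK <- : Q (above_on_grid h n) \is a fin_num by exact: fin_num_measure.
move: (fine _) (\int[Q]_w _) => p E0 EC.
rewrite -EFinB -EFinM => H.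
have {}H : (E0%:E <= ((1 - a) * (1 - p))%:E + p%:E + (c * (n%:R * h))%:E)%E.
  by apply: (le_trans H); rewrite leeD2r// leeD2l.
move: H; rewrite -!EFinD !lee_fin => H.
have cn : c * (n%:R * h) <= c * tau by rewrite ler_wpM2l.
by rewrite ler_pdivlMr//; lra.
Qed.

End markov_maximal.

(** A value below b at t < tau would persist just to the right of t, where there is a dyadic point
    (k + 1) / 2^m. The endpoint tau is an integer, hence itself dyadic. *)
Lemma right_continuous_dyadic_ge {R : realType} (phi : R -> R) (tau : nat) (b : R) :
  (forall t, 0 <= t < tau%:R -> phi s @[s --> t^'+] --> phi t) ->
  (forall m k, (k <= tau * 2 ^ m)%N -> b < phi (k%:R * 2^-1 ^+ m)) ->
  forall t, 0 <= t <= tau%:R -> b <= phi t.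
Proof.
move=> rc dy t /andP[t0]; rewrite le_eqVlt => /predU1P[->|ttau].
  by have := dy 0%N tau; rewrite muln1 expr0 mulr1 => /(_ (leqnn _))/ltW.
rewrite leNgt; apply/negP => phitb.
have tI : 0 <= t < tau%:R by rewrite t0.
have : \forall s \near t^'+, phi s < b.
  by apply: cvgr_lt phitb; exact: rc.
rewrite near_withinE => -[d /= d0 dP].
have [m md] : exists m : nat, (2^-1 : R) ^+ m < d.
  have : geometric 1 (2^-1 : R) k @[k --> \oo] --> 0.
    by apply: cvg_geometric; rewrite ger0_norm ?invf_lt1 ?ltr1n.
  move=> /cvgrPdist_lt/(_ d d0)[m _ /(_ m (leqnn m))].
  by rewrite /= sub0r normrN mul1r => Hm; exists m; exact: le_lt_trans (ler_norm _) Hm.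
have p0 : (0 : R) < 2 ^+ m by rewrite exprn_gt0.
have tp0 : 0 <= t * 2 ^+ m by rewrite mulr_ge0// ltW.
have /andP[k1 k2] := truncn_itv tp0.
set k := Num.truncn _ in k1 k2.
have ktau : (k.+1 <= tau * 2 ^ m)%N.
  rewrite -(ltr_nat R) natrM natrX; apply: le_lt_trans k1 _.
  by rewrite ltr_pM2r.
have tk : t < k.+1%:R * 2^-1 ^+ m by rewrite exprVn ltr_pdivlMr.
have kt : k.+1%:R * 2^-1 ^+ m < t + d.
  apply: (@le_lt_trans _ _ (t + 2^-1 ^+ m)); last by rewrite ltrD2l.
  rewrite -addn1 natrD mulrDl mul1r lerD2r exprVn ler_pdivrMr//.
have := dP (k.+1%:R * 2^-1 ^+ m).
rewrite /ball_ /= distrC gtr0_norm ?subr_gt0// => /(_ ltac:(lra) tk).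
by rewrite ltNge (ltW (dy _ _ ktau)).
Qed.

Section dyadic_maximal.
Context {R : realType} {d d' : measure_display}.
Context {S : measurableType d} {T : measurableType d'}.
Variables (Q : probability T R) (X : R -> T -> S) (P : R -> R.-pker S ~> S).
Hypothesis QX : markov_process Q X P.
Variables (f : R -> S -> R) (tau : nat) (c : R).
Hypothesis c0 : 0 <= c.
Hypothesis f_meas : forall t, 0 <= t <= tau%:R -> measurable_fun setT (f t).
Hypothesis f_ge0 : forall t x, 0 <= f t x.
Hypothesis f_le1 : forall t x, f t x <= 1.
Hypothesis f_lower : forall t s x, 0 <= t -> 0 <= s -> t + s <= tau%:R ->
  f t x - c * s <= \int[P s x]_y f (t + s) y.
Variable a : R.
Hypothesis a_gt0 : 0 < a.
Hypothesis a_le1 : a <= 1.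
Hypothesis f_right : forall w t, 0 <= t < tau%:R ->
  f s (X s w) @[s --> t^'+] --> f t (X t w).

                                                                              
                                   
(** The bound of [grid_maximal] does not depend on the mesh. Failure events increase as the dyadic
    grid is refined, so the bound passes to their union, and right continuity covers the other
    times. *)
Lemma markov_maximal : exists2 A : set T, measurable A &
  (Q A <= ((1 - \int[Q]_w f 0 (X 0 w) + c * tau%:R) / a)%:E)%E /\
  forall w, ~ A w -> forall t, 0 <= t <= tau%:R -> 1 - a <= f t (X t w).
Proof.
pose G m := above_on_grid X f a (2^-1 ^+ m) (tau * 2 ^ m)%N.
have h0 m : (0 : R) <= 2^-1 ^+ m by exact: exprn_ge0.
have nh m : (tau * 2 ^ m)%:R * 2^-1 ^+ m <= tau%:R :> R.
  by rewrite natrM natrX exprVn mulfK// expf_neq0.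
have mG m : measurable (G m).
  apply: (@natural_filtration_measurable _ _ _ _ _ _ _ _ QX).
  exact: (@above_on_grid_filtration _ _ _ _ _ X f tau%:R f_meas a _ _ (h0 m) (nh m)).
have mCG m : measurable (~` G m) by exact: measurableC.
exists (\bigcup_m ~` G m); first exact: bigcup_measurable.
split; last first.
  move=> w nA; apply: (@right_continuous_dyadic_ge _ (fun t => f t (X t w))).
    exact: f_right.
  move=> m k km; apply: contrapT => nfk; apply: nA; exists m => // Gw.
  by apply: nfk; exact: Gw.
have := @nondecreasing_cvg_mu _ _ _ Q (fun m => ~` G m) mCG.
move=> /(_ (bigcup_measurable (fun k _ => mCG k))) => H.
have {}H : Q (~` G m) @[m --> \oo] --> Q (\bigcup_m ~` G m).
  apply: H; apply/nondecreasing_seqP => m; apply/subsetPset; apply: subsetC.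
  (* Point k of level m is point 2k of level m + 1. *)
  move=> w Gw k km; have := Gw (2 * k)%N; rewrite expnS mulnCA leq_mul2l/= => /(_ km).
  rewrite natrM exprS mulrACA divff// ?mul1r//.
rewrite -(cvg_lim _ H)//; apply: lime_le; first by apply/cvg_ex; eexists; exact: H.
apply: nearW => m; apply: (grid_maximal QX c0 f_meas f_ge0 f_le1 f_lower a_gt0 a_le1 (h0 m) (nh m)).
Qed.

End dyadic_maximal.

                                                  

(** * The strong law of large numbers for the random field *)

(** The sum of the series has integral at most C, so it is finite almost everywhere, and the terms
    of a convergent series tend to 0. *)
Lemma ae_cvg0_of_summable {R : realType} {d : measure_display} {T : measurableType d}
    (mu : {measure set T -> \bar R}) (Y : nat -> T -> R) (C : R) :
  (forall k, measurable_fun setT (Y k)) -> (forall k w, 0 <= Y k w) ->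
  (forall n, (\sum_(0 <= k < n) \int[mu]_w (Y k w)%:E <= C%:E)%E) ->
  {ae mu, forall w, Y k w @[k --> \oo] --> 0}.
Proof.
move=> mY Y0 YC.
have mYE k : measurable_fun setT (fun w => (Y k w)%:E) by exact/measurable_EFinP.
pose Z w := (\sum_(0 <= k <oo) (Y k w)%:E)%E.
have mZ : measurable_fun setT Z.
  by apply: ge0_emeasurable_sum => // k w _ _; rewrite lee_fin.
have Z0 w : (0 <= Z w)%E by apply: nneseries_ge0 => k _ _; rewrite lee_fin.
have iZ : mu.-integrable setT Z.
  apply/integrableP; split => //.
  under eq_integral do rewrite gee0_abs//.
  rewrite integral_nneseries//; last by move=> k w _; rewrite lee_fin.
  apply: (@le_lt_trans _ _ C%:E); last exact: ltry.
  apply: lime_le; last exact: nearW.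
  by apply: is_cvg_nneseries => k _ _; apply: integral_ge0 => w _; rewrite lee_fin.
have := @integrable_ae _ _ _ mu setT measurableT _ iZ; apply: filterS => w /(_ Logic.I) Zw.
apply: cvg_series_cvg_0; apply: nondecreasing_is_cvgn.
  by apply/nondecreasing_seqP => n; rewrite /series /= big_nat_recr//= lerDl.
exists (fine (Z w)) => _ [n _ <-].
rewrite -lee_fin fineK// /series /= -sumEFin.
by apply: nneseries_lim_ge => k _ _; rewrite lee_fin.
Qed.

Lemma sum_inv_squares_le {R : realType} n :
  \sum_(0 <= k < n) (k.+1%:R ^+ 2)^-1 <= 2 :> R.
Proof.
(* The sharper bound is what the induction can propagate, since 1/(m+2)^2 <= 1/(m+1) - 1/(m+2). *)
suff H m : \sum_(0 <= k < m.+1) (k.+1%:R ^+ 2)^-1 <= 2 - m.+1%:R^-1 :> R.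
  case: n => [|m]; first by rewrite big_geq.
  by apply: (le_trans (H m)); rewrite gerBl.
elim: m => [|m IH]; first by rewrite big_nat1 expr1n invr1; lra.
rewrite big_nat_recr//=; apply: (le_trans (lerD IH (lexx _))).
have p1 : (0 : R) < m.+1%:R by [].
have p2 : (0 : R) < m.+2%:R by [].
have -> : (m.+2%:R ^+ 2)^-1 = m.+1%:R^-1 - m.+2%:R^-1 - (m.+1%:R * m.+2%:R ^+ 2)^-1 :> R.
  have E : m.+2%:R = m.+1%:R + 1 :> R by rewrite natr1.
  by rewrite E in p2 *; field; rewrite !gt_eqF.
have : 0 < (m.+1%:R * m.+2%:R ^+ 2)^-1 :> R by rewrite invr_gt0 mulr_gt0 ?exprn_gt0.
by move: (m.+1%:R^-1) (m.+2%:R^-1) ((_ * _)^-1) => x y z; lra.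
Qed.

Section law_of_large_numbers.
Context {R : realType} {d : measure_display} {Omega : measurableType d}.
Variables (P : probability Omega R) (eta : nat -> {RV P >-> R}).
Hypothesis eta_field : random_field eta.

Let etaP j w : eta j w = 1 \/ eta j w = -1.
Proof. by case: eta_field => + _ _; exact. Qed.

Lemma random_field_norm j w : `|eta j w| = 1.
Proof. by case: (etaP j w) => ->; rewrite ?normrN normr1. Qed.

Let bm j : bounded_measurable (eta j).
Proof. by split=> //; exists 1 => w; rewrite random_field_norm. Qed.

Let bmM i j : bounded_measurable (fun w => eta i w * eta j w).
Proof.
split; first exact: measurable_funM.
by exists 1 => w; rewrite normrM !random_field_norm mulr1.
Qed.

Let up j := eta j @^-1` [set (1 : R)].

Let mup j : measurable (up j).
Proof. by rewrite /up -[X in measurable X]setTI; exact: measurable_funP. Qed.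

Let Pup j : P (up j) = 2^-1%:E.
Proof.
have [_ /(_ j [set 1] (measurable_set1 _)) + _] := eta_field.
rewrite /distribution /pushforward /= => ->.
rewrite /dirac !indicE; have /negPf -> : (-1 : R) \notin [set (1 : R)].
  by apply/negP; rewrite inE /= => ?; lra.
by rewrite mem_set// add0e mule1.
Qed.

Let Pup2 i j : i != j -> P (up i `&` up j) = 4^-1%:E.
Proof.
move=> ij; have [_ _ /(_ [fset i; j]%fset (fun=> [set 1]) (fun=> measurable_set1 _))] := eta_field.
rewrite big_fsetU1 ?inE//= big_seq_fset1 -/(up i) -/(up j) !Pup.
have -> : \bigcap_(k in [set` [fset i; j]%fset]) (eta k @^-1` [set 1]) = up i `&` up j.
  apply/seteqP; split => [w H|w [Hi Hj] k /=].
    by split; apply: H; rewrite /= !inE eqxx ?orbT.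
  by rewrite !inE => /orP[/eqP->|/eqP->].
by move=> ->; rewrite -EFinM; congr EFin; field.
Qed.

Let N1 : (-1 == 1 :> R) = false. Proof. by apply/negbTE/eqP => ?; lra. Qed.

(** Each variable is twice the indicator of its value 1, minus 1. Expanding the product, the
    expectation is 4/4 - 2/2 - 2/2 + 1. *)
Lemma random_field_uncorrelated i j : i != j -> \int[P]_w (eta i w * eta j w) = 0.
Proof.
move=> ij.
have P1 : P setT = 1%E by exact: probability_setT.
have bi k : bounded_measurable (\1_(up k) : Omega -> R).
  split; first exact: measurable_indic.
  by exists 1 => w; rewrite indicE; case: (_ \in _); rewrite ?normr1 ?normr0.
have bij : bounded_measurable (\1_(up i `&` up j) : Omega -> R).
  split; first by apply: measurable_indic; exact: measurableI.
  by exists 1 => w; rewrite indicE; case: (_ \in _); rewrite ?normr1 ?normr0.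
have -> : (fun w => eta i w * eta j w) = (fun w => (4 * \1_(up i `&` up j) w +
    (- 2 * \1_(up i) w + - 2 * \1_(up j) w)) + 1).
  apply/funext => w; rewrite !indicE in_setI /up.
  have E k : (w \in eta k @^-1` [set (1 : R)]) = (eta k w == 1).
    by apply/idP/eqP; rewrite inE.
  rewrite !E; case: (etaP i w) => ->; case: (etaP j w) => ->; rewrite ?eqxx ?N1 /=; ring.
have b2 k := bounded_measurableZ (- 2) (bi k).
rewrite (Rintegral_boundedD P1 (bounded_measurableD (bounded_measurableZ 4 bij)
  (bounded_measurableD (b2 i) (b2 j))) (bounded_measurable_cst 1)).
rewrite (Rintegral_boundedD P1 (bounded_measurableZ 4 bij) (bounded_measurableD (b2 i) (b2 j))).
rewrite (Rintegral_boundedD P1 (b2 i) (b2 j)) (Rintegral_bounded_cst P1).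
rewrite !(Rintegral_boundedZ P1)//.
have mI : measurable (up i `&` up j) by exact: measurableI.
rewrite /Rintegral !integral_indic// !setIT.
transitivity (4 * fine (4^-1%:E : \bar R) +
    (- 2 * fine (2^-1%:E : \bar R) + - 2 * fine (2^-1%:E : \bar R)) + 1).
  congr (4 * fine _ + (- 2 * fine _ + - 2 * fine _) + 1).
  - exact: Pup2.
  - exact: Pup.
  - exact: Pup.
by rewrite /=; field.
Qed.

Let S N w := \sum_(j < N) eta j w.

Lemma random_field_sum_variance N : \int[P]_w (S N w) ^+ 2 = N%:R.
Proof.
have P1 : P setT = 1%E by exact: probability_setT.
have bS M : bounded_measurable (S M).
  elim: M => [|M IH].
    by rewrite (_ : S 0 = fun=> 0) ?funeqE// => [|w]; [exact: bounded_measurable_cst|rewrite /S big_ord0].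
  rewrite (_ : S M.+1 = fun w => S M w + eta M w) ?funeqE// => [|w].
    exact: bounded_measurableD.
  by rewrite /S big_ord_recr.
have bSM M : bounded_measurable (fun w => S M w ^+ 2).
  have [mS [C SC]] := bS M; split; first exact: measurable_funX.
  by exists (C ^+ 2) => w; rewrite normrX lerXn2r// ?nnegrE// (le_trans _ (SC w)).
have bSe M j : bounded_measurable (fun w => S M w * eta j w).
  have [mS [C SC]] := bS M; split; first exact: measurable_funM.
  by exists C => w; rewrite normrM random_field_norm mulr1.
have SE M j : (M <= j)%N -> \int[P]_w (S M w * eta j w) = 0.
  elim: M => [|M IH] Mj.
    under eq_Rintegral do rewrite /S big_ord0 mul0r.
    by rewrite (Rintegral_bounded_cst P1).
  under eq_Rintegral do rewrite /S big_ord_recr /= mulrDl.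
  rewrite (Rintegral_boundedD P1 (bSe M j) (bmM M j)) IH ?add0r; last exact: ltnW.
  by rewrite random_field_uncorrelated// neq_ltn Mj.
elim: N => [|N IH].
  under eq_Rintegral do rewrite /S big_ord0 expr0n.
  by rewrite (Rintegral_bounded_cst P1).
have -> : (fun w => S N.+1 w ^+ 2) = (fun w => (S N w ^+ 2 + 2 * (S N w * eta N w)) + 1).
  apply/funext => w; rewrite /S big_ord_recr /= sqrrD.
  have -> : eta N w ^+ 2 = 1 by case: (etaP N w) => ->; ring.
  by rewrite mulr_natl.
rewrite (Rintegral_boundedD P1 (bounded_measurableD (bSM N) (bounded_measurableZ 2 (bSe N N)))
  (bounded_measurable_cst 1)).
rewrite (Rintegral_boundedD P1 (bSM N) (bounded_measurableZ 2 (bSe N N))).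
rewrite (Rintegral_boundedZ P1)// SE// IH mulr0 addr0 (Rintegral_bounded_cst P1).
by rewrite -natr1.
Qed.

Lemma square_bracket N : exists k, (k ^ 2 <= N < k.+1 ^ 2)%N.
Proof.
elim: N => [|N [k /andP[k1 k2]]]; first by exists 0%N.
have [Nk|Nk] := ltnP N.+1 (k.+1 ^ 2); first by exists k; rewrite leqW.
by exists k.+1; rewrite Nk /= (leq_trans (n := (k.+1 ^ 2).+1))// ltn_exp2r.
Qed.

Let S_increment N M w : (N <= M)%N -> `|S M w| <= `|S N w| + (M - N)%:R.
Proof.
move=> NM; rewrite -[X in `|S X w|](subnKC NM); elim: (M - N)%N => [|m IH].
  by rewrite addn0 addr0.
rewrite addnS /S big_ord_recr /=; apply: (le_trans (ler_normD _ _)).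
by rewrite random_field_norm -natr1 addrA lerD2r.
Qed.

                                                                        
                                                       
(** At N = k^2 the second moment of S N / N is 1/k^2, which is summable, so convergence holds along
    squares. Between k^2 and (k + 1)^2 the sum moves by at most 2k, negligible against k^2. *)
Lemma random_field_lln : {ae P, forall w, S N w / N%:R @[N --> \oo] --> 0}.
Proof.
pose Y k w := (S (k.+1 ^ 2) w / (k.+1 ^ 2)%:R) ^+ 2.
have mS N : measurable_fun setT (S N).
  by apply: measurable_sum => j; exact: measurable_funP.
have mY k : measurable_fun setT (Y k).
  by apply: measurable_funX; apply: measurable_funM => //; exact: measurable_cst.
have P1 : P setT = 1%E by exact: probability_setT.
have SN N w : `|S N w| <= N%:R.
  by have := S_increment w (leq0n N); rewrite subn0 [X in `|X| + _]/S big_ord0 normr0 add0r.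
have iY k : (\int[P]_w (Y k w)%:E = ((k.+1%:R ^+ 2)^-1)%:E)%E.
  have bS : bounded_measurable (fun w => S (k.+1 ^ 2) w ^+ 2).
    split; first exact: measurable_funX.
    by exists ((k.+1 ^ 2)%:R ^+ 2) => w; rewrite normrX lerXn2r// nnegrE.
  have YE : Y k = fun w => ((k.+1 ^ 2)%:R ^+ 2)^-1 * S (k.+1 ^ 2) w ^+ 2.
    by apply/funext => w; rewrite /Y expr_div_n mulrC.
  rewrite -(EFin_Rintegral_bounded P1); last by rewrite YE; exact: bounded_measurableZ.
  congr EFin; rewrite YE (Rintegral_boundedZ P1)// random_field_sum_variance natrX.
  by rewrite [X in X^-1 * _]expr2 invfM -mulrA mulVf ?mulr1// expf_neq0.
have sumY n : (\sum_(0 <= k < n) \int[P]_w (Y k w)%:E <= 2%:E)%E.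
  under eq_bigr do rewrite iY.
  by rewrite sumEFin lee_fin; exact: sum_inv_squares_le.
have := @ae_cvg0_of_summable _ _ _ P Y 2 mY (fun k w => sqr_ge0 _) sumY.
apply: filterS => w Yw; apply/cvgrPdist_le => e e0.
have e2 : 0 < (e / 2) ^+ 2 by rewrite exprn_gt0//; lra.
move/cvgrPdist_le : Yw => /(_ _ e2)[K _ KP].
(* For k >= 4 / e the gap 2k is at most (e / 2) k^2, which adds up with the e / 2 obtained along
   squares. *)
pose K' := (Num.truncn (4 / e)).+1.
exists ((maxn K K').+1 ^ 2)%N => // N /= KN.
rewrite sub0r normrN.
have [k /andP[k1 k2]] := square_bracket N.
have Kk : ((maxn K K').+1 <= k)%N.
  by rewrite -ltnS -(ltn_exp2r _ _ (isT : 0 < 2)%N); exact: leq_ltn_trans KN k2.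
have Nk : (N - k ^ 2 <= 2 * k)%N.
  have E : (k.+1 ^ 2 = k ^ 2 + 2 * k + 1)%N by rewrite -[k.+1]addn1 sqrnD; lia.
  by move: k2; rewrite E; lia.
case: k Kk k1 k2 Nk => // k; rewrite ltnS geq_max => /andP[Kk K'k] k1 _ Nk.
have := KP k Kk; rewrite sub0r normrN /Y normrX ler_sqr ?nnegrE//; last by lra.
have pk : (0 : R) < (k.+1 ^ 2)%:R by rewrite ltr0n expn_gt0.
rewrite normrM normfV [X in _ / X]gtr0_norm// ler_pdivrMr// => H1.
have pN : (0 : R) < N%:R by rewrite ltr0n; apply: leq_trans k1; rewrite expn_gt0.
rewrite normrM normfV [X in _ / X]gtr0_norm// ler_pdivrMr//.
apply: (le_trans (S_increment w k1)).
have H2 : (N - k.+1 ^ 2)%:R <= 2 * k.+1%:R :> R by rewrite -natrM ler_nat.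
have H3 : 4 / e <= k.+1%:R.
  have /ltW := truncnS_gt (4 / e); rewrite -/K' => /le_trans; apply.
  by rewrite ler_nat leqW.
have H4 : (k.+1 ^ 2)%:R <= N%:R :> R by rewrite ler_nat.
move: H3; rewrite ler_pdivrMr// => H3.
have H5 : 4 * k.+1%:R <= k.+1%:R * e * k.+1%:R by rewrite ler_pM2r.
have H6 : (k.+1 ^ 2)%:R * e <= N%:R * e by rewrite ler_pM2r.
rewrite natrX in H1 H4 H6 *; lra.
Qed.

End law_of_large_numbers.

                              

(** * Truncation by the positive part and the domain of the generator *)

Section positive_part.
Context {R : realType}.
Implicit Types u v : R.

Definition pos_part u : R := Num.max u 0.

Lemma pos_part_ge0 u : 0 <= pos_part u.
Proof. by rewrite le_max lexx orbT. Qed.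

Lemma pos_part_pos u : 0 <= u -> pos_part u = u.
Proof. by move=> u0; rewrite /pos_part max_l. Qed.

Lemma pos_part_neg u : u <= 0 -> pos_part u = 0.
Proof. by move=> u0; rewrite /pos_part max_r. Qed.

Lemma continuous_pos_part : continuous pos_part.
Proof. exact: continuous_max_cst. Qed.

(** Powers at least 2 are C^1; at the kink, Caratheodory's slope function is the power of one degree
    less. *)
Lemma is_derive_pos_part n u :
  is_derive u 1 (fun v => pos_part v ^+ n.+2) (n.+2%:R * pos_part u ^+ n.+1).
Proof.
have [u0|u0|->] := ltrgtP u 0.
- rewrite pos_part_neg ?ltW// expr0n mulr0.
  apply: near_eq_is_derive (is_derive_cst 0 u 1); near=> v.
  have v0 : v < 0 by near: v; exact: lt_nbhsl.
  by rewrite pos_part_neg ?ltW// expr0n.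
- rewrite pos_part_pos ?ltW//.
  apply: (@near_eq_is_derive _ _ _ (fun v => v ^+ n.+2)).
    near=> v; have v0 : 0 < v by near: v; exact: lt_nbhsr.
    by rewrite pos_part_pos ?ltW.
  apply: (is_derive_eq (is_derive_exp n.+2 (is_derive_id u 1))).
  by rewrite mulr1.
- rewrite pos_part_pos// expr0n mulr0; apply/is_derive1_caratheodory.
  exists (fun v => pos_part v ^+ n.+1); split.
  + move=> v; rewrite (pos_part_pos (lexx 0)) expr0n !subr0 exprSr.
    have [v0|v0] := leP 0 v; first by rewrite pos_part_pos.
    by rewrite pos_part_neg ?ltW// expr0n !mul0r.
  + exact: (continuous_cvg _ (@exprn_continuous _ n.+1 _) (@continuous_pos_part 0)).
  + by rewrite pos_part_pos// expr0n.
Unshelve. all: by end_near. Qed.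

(** The tangent-line inequality of a convex function. It makes increments of the truncated distance
    linear, in the direction needed for lower bounds. *)
Lemma pos_part_cube_convex u v :
  pos_part u ^+ 3 + 3 * pos_part u ^+ 2 * (v - u) <= pos_part v ^+ 3.
Proof.
have [u0|u0] := leP u 0.
  by rewrite (pos_part_neg u0) !expr0n/= mulr0 mul0r addr0 exprn_ge0// pos_part_ge0.
rewrite (pos_part_pos (ltW u0)).
have [v0|v0] := leP v 0.
  rewrite (pos_part_neg v0) expr0n/=.
  have : 0 <= u ^+ 2 by rewrite sqr_ge0.
  by move=> u2; nra.
rewrite (pos_part_pos (ltW v0)).
(* This product is exactly v^3 - u^3 - 3 u^2 (v - u). *)
have : 0 <= (v - u) ^+ 2 * (v + 2 * u) by rewrite mulr_ge0 ?sqr_ge0//; lra.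
by move=> ?; lra.
Qed.

End positive_part.

Lemma compact_support_bounded {R : realType} (h : R -> R) (K : R) :
  continuous h -> (forall l, K < `|l| -> h l = 0) -> exists B : R, forall l, `|h l| <= B.
Proof.
move=> ch hK.
have [l0 _ l0P] : exists2 c, c \in `[- `|K|, `|K|]%R &
    forall t, t \in `[- `|K|, `|K|]%R -> `|h t| <= `|h c|.
  apply: (@EVT_max _ (fun l => `|h l|)); first by have := normr_ge0 K; lra.
  by apply: continuous_subspaceT => l; apply: cvg_norm; exact: ch.
exists `|h l0| => l; have [lK|lK] := leP `|l| `|K|.
  by apply: l0P; rewrite in_itv /= -ler_norml.
by rewrite hK ?normr0// (le_lt_trans (ler_norm K)).
Qed.

Section micro_domain_theory.
Context {R : realType} (N : nat).
Implicit Types f : config N * R -> R.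

Lemma measurable_config_sections f :
  (forall s, continuous (fun l => f (s, l))) -> measurable_fun setT f.
Proof.
move=> cf _ A mA; rewrite setTI.
have -> : f @^-1` A =
    \bigcup_(s in [set: {ffun 'I_N -> bool}]) (([set s] : set (config N)) `*` ((fun l => f (s, l)) @^-1` A)).
  apply/seteqP; split => [[s l] /= Af|[s l] [s' _ [/= -> Af]]//].
  by exists s.
apply: fin_bigcup_measurable => [|s _]; first exact: finite_finset.
apply: measurableX => //.
rewrite -[X in measurable X]setTI; apply: continuous_measurable_fun => //.
Qed.

Lemma micro_domain_continuous f : micro_domain f ->
  forall s, continuous (fun l => f (s, l)).
Proof.
move=> Df s l; have [dl _ _] := Df s.
by have /derivable1_diffP/differentiable_continuous := dl l.
Qed.

Lemma config_bound (h : config N -> R -> R) :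
  (forall s, exists B : R, forall l, `|h s l| <= B) ->
  exists B : R, forall s l, `|h s l| <= B.
Proof.
move=> /choice[B BP]; exists (\sum_(s : {ffun 'I_N -> bool}) `|B s|) => s l.
apply: (le_trans (BP s l)); apply: (le_trans (ler_norm _)).
by rewrite (bigD1 (s : {ffun 'I_N -> bool}))//= lerDl sumr_ge0.
Qed.

Lemma micro_domain_bounded f : micro_domain f -> bounded_measurable f.
Proof.
move=> Df; split; first by apply: measurable_config_sections; exact: micro_domain_continuous.
have [s|B BP] := @config_bound (fun s l => f (s, l)).
  have [_ _ [K KP]] := Df s.
  exact: compact_support_bounded (micro_domain_continuous Df (s := s)) KP.
by exists B => -[s l].
Qed.

(** Flip rates are at most 2, and the unbounded coefficient l multiplies a derivative that is
    continuous with compact support. *)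
Lemma micro_generator_bounded beta h eta f : (forall j, `|eta j| = 1) ->
  micro_domain f -> exists M : R, forall x, `|micro_generator beta h eta f x| <= M.
Proof.
move=> eta1 Df.
have [_ [B BP]] := micro_domain_bounded Df.
have [s|B' B'P] := @config_bound (fun s l => l * derive1 (fun l' => f (s, l')) l).
  have [_ cd [K KP]] := Df s.
  apply: (@compact_support_bounded _ _ K) => [l|l Kl].
    by apply: cvgM; [exact: cvg_id|exact: cd].
  suff -> : derive1 (fun l' => f (s, l')) l = 0 by rewrite mulr0.
  rewrite derive1E; apply: derive_val.
  apply: near_eq_is_derive (is_derive_cst (0 : R) l 1); near=> u.
  rewrite KP//; near: u.
  apply: (@cvgr_gt _ _ _ _ (fun u : R => `|u|) `|l|) => //.
  exact: (@norm_continuous R R l).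
exists (\sum_(j < N) 2 * (B + B) + B') => -[s l].
rewrite /micro_generator; apply: (le_trans (ler_normB _ _)); apply: lerD => //.
apply: (le_trans (ler_norm_sum _ _ _)); apply: ler_sum => j _.
rewrite normrM; apply: ler_pM => //.
  apply: (le_trans (ler_normB _ _)); rewrite normr1 -[leRHS]/(1 + 1) lerD2l normrM.
  have -> : `|spin (s j)| = 1 :> R by rewrite /spin; case: (s j); rewrite ?normrN normr1.
  by rewrite mul1r normr_tanh_le1.
by apply: (le_trans (ler_normB _ _)); exact: lerD.
Unshelve. all: by end_near. Qed.

(** Cutting off where r >= 1 gives compact support, and the exponent n + 2 gives a C^1 cutoff. It is
    applied both to the Lyapunov function (n = 1) and to its time derivative (n = 0). *)
Lemma capped_micro_domain (n : nat) (r w : config N -> R -> R) (dr dw : config N -> R -> R) :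
  (forall s (l : R), is_derive l 1 (r s) (dr s l)) ->
  (forall s (l : R), is_derive l 1 (w s) (dw s l)) ->
  (forall s, continuous (dr s)) -> (forall s, continuous (dw s)) ->
  (forall s, exists K : R, forall l, K < `|l| -> 1 <= r s l) ->
  micro_domain (fun x : config N * R => pos_part (1 - r x.1 x.2) ^+ n.+2 * w x.1 x.2)
  /\ (forall s (l : R), derive1 (fun l' => pos_part (1 - r s l') ^+ n.+2 * w s l') l =
        n.+2%:R * pos_part (1 - r s l) ^+ n.+1 * - dr s l * w s l
        + pos_part (1 - r s l) ^+ n.+2 * dw s l).
Proof.
move=> rd wd cdr cdw rK.
have D s (l : R) : is_derive l 1 (fun l' => pos_part (1 - r s l') ^+ n.+2 * w s l')
    (n.+2%:R * pos_part (1 - r s l) ^+ n.+1 * - dr s l * w s l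
        + pos_part (1 - r s l) ^+ n.+2 * dw s l).
  apply: is_derive_mul (wd s l).
  apply: (@is_derive_comp _ (fun v => pos_part v ^+ n.+2) (fun l => 1 - r s l)).
    exact: is_derive_pos_part.
  by rewrite -[- dr s l]sub0r; apply: is_derive_sub.
have dE s (l : R) : derive1 (fun l' => pos_part (1 - r s l') ^+ n.+2 * w s l') l =
        n.+2%:R * pos_part (1 - r s l) ^+ n.+1 * - dr s l * w s l
        + pos_part (1 - r s l) ^+ n.+2 * dw s l.
  by rewrite derive1E; apply: derive_val.
split; last exact: dE.
move=> s; split => /=.
- by move=> l; case: (D s l).
- have cr : continuous (r s) by move=> l; exact: is_derive_continuous (rd s l).
  have cw : continuous (w s) by move=> l; exact: is_derive_continuous (wd s l).
  have cp k : continuous (fun l => pos_part (1 - r s l) ^+ k).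
    move=> l; apply: (continuous_cvg _ (@exprn_continuous _ k _)).
    apply: (continuous_cvg _ (@continuous_pos_part _ _)).
    by apply: cvgB; [exact: cvg_cst|exact: cr].
  rewrite (funext (dE s)) => l; apply: cvgD.
    apply: cvgM; last exact: cw.
    apply: cvgM; last by apply: cvgN; exact: cdr.
    by apply: cvgM; [exact: cvg_cst|exact: cp].
  by apply: cvgM; [exact: cp|exact: cdw].
- have [K KP] := rK s; exists K => l /KP rl.
  by rewrite pos_part_neg ?subr_le0// expr0n mul0r.
Qed.

End micro_domain_theory.

(** * The generator on squared distances *)

Section drift.
Context {R : realType}.
Variables beta h : R.
Hypothesis beta_gt0 : 0 < beta.
Implicit Types m q l : R.

Definition drift_m m l : R := - 2 * m + tanh (l + h) + tanh (l - h).
Definition drift_q q l : R := - 2 * q + tanh (l + h) - tanh (l - h).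
Definition drift_l m l : R := - l + beta * drift_m m l.

Lemma mulr_le_abs (x y : R) (k : R) : `|y| <= k -> x * y <= `|x| * k.
Proof.
move=> yk; apply: (le_trans (ler_norm _)); rewrite normrM ler_wpM2l//.
Qed.

(** With u, v, w the differences of the coordinates, the part without beta is at most -(2|u| -
    |w|)^2 - (2|v| - |w|)^2 <= 0. The part with beta is at most beta (4 w^2 - 4 u w), hence at most
    beta (2 u^2 + 6 w^2). *)
Lemma drift_one_sided_lipschitz m q l m' q' l' :
  2 * (m - m') * (drift_m m l - drift_m m' l') +
  2 * (q - q') * (drift_q q l - drift_q q' l') +
  2 * (l - l') * (drift_l m l - drift_l m' l') <=
  6 * beta * ((m - m') ^+ 2 + (q - q') ^+ 2 + (l - l') ^+ 2).
Proof.
rewrite /drift_l /drift_m /drift_q.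
have dp : `|tanh (l + h) - tanh (l' + h)| <= `|l - l'|.
  by apply: (le_trans (tanh_lipschitz _ _)); rewrite (_ : _ - _ = l - l')//; ring.
have dn : `|tanh (l - h) - tanh (l' - h)| <= `|l - l'|.
  by apply: (le_trans (tanh_lipschitz _ _)); rewrite (_ : _ - _ = l - l')//; ring.
move: dp dn; set P := _ - tanh (l' + h); set M := _ - tanh (l' - h) => dp dn.
pose u := m - m'; pose v := q - q'; pose w := l - l'.
have -> : - 2 * m + tanh (l + h) + tanh (l - h) -
    (- 2 * m' + tanh (l' + h) + tanh (l' - h)) = - 2 * u + P + M.
  by rewrite /P /M /u; ring.
have -> : - 2 * q + tanh (l + h) - tanh (l - h) -
    (- 2 * q' + tanh (l' + h) - tanh (l' - h)) = - 2 * v + P - M.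
  by rewrite /P /M /v; ring.
have -> : - l + beta * (- 2 * m + tanh (l + h) + tanh (l - h)) -
    (- l' + beta * (- 2 * m' + tanh (l' + h) + tanh (l' - h))) =
    - w + beta * (- 2 * u + P + M).
  by rewrite /P /M /u /w; ring.
rewrite -/u -/v -/w; move: dp dn; rewrite -/w.
move: (P) (M) (u) (v) (w) => {P M u v w} P M u v w dp dn.
have w2 : `|w| ^+ 2 = w ^+ 2 by rewrite real_normK// num_real.
have u2 : `|u| ^+ 2 = u ^+ 2 by rewrite real_normK// num_real.
have v2 : `|v| ^+ 2 = v ^+ 2 by rewrite real_normK// num_real.
have b1 := mulr_le_abs u dp; have b2 := mulr_le_abs u dn.
have b3 := mulr_le_abs v dp.
have b4 : v * - M <= `|v| * `|w| by apply: mulr_le_abs; rewrite normrN.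
have b5 := mulr_le_abs w dp; have b6 := mulr_le_abs w dn.
have s1 := sqr_ge0 (2 * `|u| - `|w|); have s2 := sqr_ge0 (2 * `|v| - `|w|).
have s3 := sqr_ge0 (u + w).
have c5 : beta * (w * P) <= beta * (`|w| * `|w|) by rewrite ler_pM2l.
have c6 : beta * (w * M) <= beta * (`|w| * `|w|) by rewrite ler_pM2l.
have c7 : 0 <= beta * (u + w) ^+ 2 by rewrite mulr_ge0// ltW.
have c8 : 0 <= beta * u ^+ 2 by rewrite mulr_ge0 ?sqr_ge0// ltW.
have c9 : 0 <= beta * v ^+ 2 by rewrite mulr_ge0 ?sqr_ge0// ltW.
have {}c5 : beta * (w * P) <= beta * w ^+ 2 by rewrite -w2 expr2.
have {}c6 : beta * (w * M) <= beta * w ^+ 2 by rewrite -w2 expr2.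
move: s1 s2; rewrite !sqrrB !exprMn !w2 !u2 !v2.
move: b1 b2 b3 b4; move: (`|u|) (`|v|) (`|w|) => U V W *.
lra.
Qed.

End drift.

Section generator_bound.
Context {R : realType}.
Variables (beta h : R) (eta : nat -> R) (N : nat).
Hypothesis beta_gt0 : 0 < beta.
Hypothesis etaP : forall j, eta j = 1 \/ eta j = -1.
Hypothesis N_gt0 : (0 < N)%N.
Implicit Types s : config N.

Definition rate s (l : R) (j : 'I_N) : R := 1 - spin (s j) * tanh (l + h * eta j).
Definition magn s : R := (\sum_(j < N) spin (s j)) / N%:R.
Definition stag s : R := (\sum_(j < N) spin (s j) * eta j) / N%:R.
Definition eta_mean : R := (\sum_(j < N) eta j) / N%:R.

Lemma spin_sqr (b : bool) : spin b ^+ 2 = 1 :> R.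
Proof. by rewrite /spin; case: b; rewrite ?sqrrN expr1n. Qed.

Let N0 : N%:R != 0 :> R. Proof. by rewrite pnatr_eq0 -lt0n. Qed.

Lemma sum_spin_flip s i (e : 'I_N -> R) :
  \sum_(j < N) spin (flip s i j) * e j =
  \sum_(j < N) spin (s j) * e j - 2 * spin (s i) * e i.
Proof.
rewrite (bigD1 i)//= [in RHS](bigD1 i)//=.
have -> : spin (flip s i i) = - spin (s i) :> R.
  by rewrite /flip ffunE eqxx /spin; case: (s i); rewrite ?opprK.
have -> : \sum_(j < N | j != i) spin (flip s i j) * e j = \sum_(j < N | j != i) spin (s j) * e j.
  by apply: eq_bigr => j ji; rewrite /flip ffunE (negbTE ji).
by ring.
Qed.

Lemma magn_flip s i : magn (flip s i) = magn s - 2 * spin (s i) / N%:R.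
Proof.
have := sum_spin_flip s i (fun=> 1).
under eq_bigr do rewrite mulr1.
under [in X in _ = X -> _]eq_bigr do rewrite mulr1.
by rewrite /magn mulr1 => ->; rewrite mulrBl.
Qed.

Lemma stag_flip s i : stag (flip s i) = stag s - 2 * spin (s i) * eta i / N%:R.
Proof. by rewrite /stag (sum_spin_flip s i (fun j => eta j)) mulrBl. Qed.

(** A function of a sign is affine in it. This is why the sums over sites close in terms of [magn],
    [stag] and [eta_mean]. *)
Let tanhE l j : tanh (l + h * eta j) =
  (tanh (l + h) + tanh (l - h)) / 2 + (tanh (l + h) - tanh (l - h)) / 2 * eta j.
Proof. by case: (etaP j) => ->; rewrite ?mulr1 ?mulrN1; field. Qed.

Lemma sum_rate_spin s l : \sum_(j < N) rate s l j * spin (s j) =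
  N%:R * (magn s - (tanh (l + h) + tanh (l - h)) / 2 -
    (tanh (l + h) - tanh (l - h)) / 2 * eta_mean).
Proof.
transitivity (\sum_(j < N) (spin (s j) + (- ((tanh (l + h) + tanh (l - h)) / 2)
    - (tanh (l + h) - tanh (l - h)) / 2 * eta j))).
  apply: eq_bigr => j _; rewrite /rate tanhE.
  have := spin_sqr (s j); move: (spin (s j)) => x x2.
  by rewrite mulrBl mul1r mulrAC -expr2 x2 mul1r; ring.
rewrite !big_split /= sumr_const card_ord sumrN -mulr_sumr /magn /eta_mean.
by rewrite -[(- _) *+ N]mulr_natl; field.
Qed.

Lemma sum_rate_spin_eta s l : \sum_(j < N) rate s l j * spin (s j) * eta j =
  N%:R * (stag s - (tanh (l + h) - tanh (l - h)) / 2 -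
    (tanh (l + h) + tanh (l - h)) / 2 * eta_mean).
Proof.
transitivity (\sum_(j < N) (spin (s j) * eta j + (- ((tanh (l + h) - tanh (l - h)) / 2)
    - (tanh (l + h) + tanh (l - h)) / 2 * eta j))).
  apply: eq_bigr => j _; rewrite /rate tanhE.
  have := spin_sqr (s j); move: (spin (s j)) => x x2.
  have e2 : eta j ^+ 2 = 1 by case: (etaP j) => ->; rewrite ?sqrrN expr1n.
  rewrite [(1 - _) * x]mulrBl mul1r [x * _ * x]mulrAC -expr2 x2 mul1r.
  by rewrite mulrBl mulrDl -[_ * eta j * eta j]mulrA -expr2 e2; ring.
rewrite !big_split /= sumr_const card_ord sumrN -mulr_sumr /stag /eta_mean.
by rewrite -[(- _) *+ N]mulr_natl; field.
Qed.

Lemma rate_bounds s l j : 0 <= rate s l j <= 2.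
Proof.
have : `|spin (s j) * tanh (l + h * eta j)| <= 1.
  by rewrite normrM /spin; case: (s j); rewrite ?normrN normr1 mul1r normr_tanh_le1.
by rewrite /rate ler_norml => /andP[? ?]; apply/andP; split; lra.
Qed.

Lemma sum_rate_le s l : \sum_(j < N) rate s l j <= 2 * N%:R.
Proof.
have : \sum_(j < N) rate s l j <= \sum_(j < N) (2 : R).
  by apply: ler_sum => j _; case/andP: (rate_bounds s l j).
by rewrite sumr_const card_ord mulr_natr.
Qed.

Definition sqdist (a b c : R) s l : R :=
  (magn s - a) ^+ 2 + (stag s - b) ^+ 2 + (l - c) ^+ 2.

(** The distance is quadratic, so the expansion is exact: first-order terms give the limiting drift
    corrected by multiples of [eta_mean], and each jump adds the second-order amount (2/N)^2 (1 + 1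
    + beta^2). *)
Lemma generator_sqdist a b c s l :
  \sum_(j < N) rate s l j *
    (sqdist a b c (flip s j) (l - 2 * beta * spin (s j) / N%:R) - sqdist a b c s l)
  - l * (2 * (l - c)) =
  2 * (magn s - a) * (drift_m h (magn s) l + (tanh (l + h) - tanh (l - h)) * eta_mean) +
  2 * (stag s - b) * (drift_q h (stag s) l + (tanh (l + h) + tanh (l - h)) * eta_mean) +
  2 * (l - c) * (drift_l beta h (magn s) l + beta * ((tanh (l + h) - tanh (l - h)) * eta_mean)) +
  4 * (2 + beta ^+ 2) / N%:R ^+ 2 * \sum_(j < N) rate s l j.
Proof.
have -> : \sum_(j < N) rate s l j *
    (sqdist a b c (flip s j) (l - 2 * beta * spin (s j) / N%:R) - sqdist a b c s l) =
  (- 4 / N%:R * (magn s - a + beta * (l - c))) * \sum_(j < N) rate s l j * spin (s j) +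
  (- 4 / N%:R * (stag s - b)) * \sum_(j < N) rate s l j * spin (s j) * eta j +
  4 * (2 + beta ^+ 2) / N%:R ^+ 2 * \sum_(j < N) rate s l j.
  rewrite !mulr_sumr -!big_split /=; apply: eq_bigr => j _.
  rewrite /sqdist magn_flip stag_flip.
  have := spin_sqr (s j).
  have : eta j ^+ 2 = 1 by case: (etaP j) => ->; rewrite ?sqrrN expr1n.
  move: (spin (s j)) (eta j) (magn s) (stag s) (rate s l j) => x e M S k e2 x2.
  have -> : (M - 2 * x / N%:R - a) ^+ 2 + (S - 2 * x * e / N%:R - b) ^+ 2 +
      (l - 2 * beta * x / N%:R - c) ^+ 2 - ((M - a) ^+ 2 + (S - b) ^+ 2 + (l - c) ^+ 2) =
    - 4 / N%:R * (M - a + beta * (l - c)) * x - 4 / N%:R * (S - b) * x * e +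
    4 / N%:R ^+ 2 * (x ^+ 2 + x ^+ 2 * e ^+ 2 + beta ^+ 2 * x ^+ 2) by field.
  by rewrite x2 e2; field.
rewrite sum_rate_spin sum_rate_spin_eta /drift_l /drift_m /drift_q.
by field.
Qed.

(** The subtracted drifts at (a, b, c) are the motion of the limit path. Differences of drifts cost
    6 beta. Young's inequality on the three cross terms with [eta_mean] costs the extra 1 and leaves
    4 + 4 + 4 beta^2 times its square. A total rate of at most 2N leaves the last term. *)
Lemma generator_sqdist_le a b c s l :
  \sum_(j < N) rate s l j *
    (sqdist a b c (flip s j) (l - 2 * beta * spin (s j) / N%:R) - sqdist a b c s l)
  - l * (2 * (l - c)) - 2 * (magn s - a) * drift_m h a c
  - 2 * (stag s - b) * drift_q h b c - 2 * (l - c) * drift_l beta h a c <=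
  (6 * beta + 1) * sqdist a b c s l +
  (4 * (2 + beta ^+ 2) * eta_mean ^+ 2 + 8 * (2 + beta ^+ 2) / N%:R).
Proof.
rewrite generator_sqdist.
have H1 := drift_one_sided_lipschitz h beta_gt0 (magn s) (stag s) l a b c.
have H2 : 4 * (2 + beta ^+ 2) / N%:R ^+ 2 * \sum_(j < N) rate s l j <=
    8 * (2 + beta ^+ 2) / N%:R.
  have Np : (0 : R) < N%:R by rewrite ltr0n.
  have -> : 8 * (2 + beta ^+ 2) / N%:R = 4 * (2 + beta ^+ 2) / N%:R ^+ 2 * (2 * N%:R) by field.
  apply: ler_wpM2l (sum_rate_le s l).
  by rewrite divr_ge0 ?sqr_ge0// mulr_ge0// addr_ge0 ?sqr_ge0.
have tb x y : `|tanh (x : R)| <= 1 -> `|tanh (y : R)| <= 1 -> `|tanh x + tanh y| <= 2.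
  by move=> x1 y1; apply: (le_trans (ler_normD _ _)); lra.
have tb' x y : `|tanh (x : R)| <= 1 -> `|tanh (y : R)| <= 1 -> `|tanh x - tanh y| <= 2.
  by move=> x1 y1; apply: (le_trans (ler_normB _ _)); lra.
have p := normr_tanh_le1 (l + h); have n := normr_tanh_le1 (l - h).
have {tb}tD := tb _ _ p n; have {tb'}tB := tb' _ _ p n.
move: tD tB; set D := _ + _; set B := _ - _ => tD tB.
have sq2 (x : R) : `|x| <= 2 -> x ^+ 2 <= 4.
  by rewrite ler_norml => /andP[? ?]; nra.
have young (x y : R) : 2 * x * y <= x ^+ 2 + y ^+ 2.
  by have := sqr_ge0 (x - y); rewrite sqrrB; lra.
have y1 := young (magn s - a) (B * eta_mean).
have y2 := young (stag s - b) (D * eta_mean).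
have y3 := young (l - c) (beta * (B * eta_mean)).
have e2 := sqr_ge0 eta_mean.
have q1 : (B * eta_mean) ^+ 2 <= 4 * eta_mean ^+ 2.
  by rewrite exprMn ler_wpM2r// sq2.
have q2 : (D * eta_mean) ^+ 2 <= 4 * eta_mean ^+ 2.
  by rewrite exprMn ler_wpM2r// sq2.
have q3 : (beta * (B * eta_mean)) ^+ 2 <= beta ^+ 2 * (4 * eta_mean ^+ 2).
  by rewrite exprMn ler_wpM2l// sqr_ge0.
move: H1 H2 y1 y2 y3 q1 q2 q3; rewrite /sqdist.
move: (drift_m h _ _) (drift_m h _ _) (drift_q h _ _) (drift_q h _ _)
  (drift_l beta h _ _) (drift_l beta h _ _).
move: (_ * \sum_(j < N) _) (8 * _ / _) => Z1 Z2 d1 d2 d3 d4 d5 d6.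
move: (B * eta_mean) (D * eta_mean) (eta_mean ^+ 2) (magn s) (stag s) => X1 X2 X3 X4 X5.
move=> *; lra.
Qed.

End generator_bound.

(** The arithmetic that ends [lyapunov_right_derivative]: p is a squared positive part, u a time
    step, r1, r2, r3 the new scaled distance, the old one and its time derivative. *)
Lemma slope_combination {R : realType} (F p u e e' B r1 r2 r3 n : R) :
  p * (r1 - r2 - u * r3) <= p * (e' * u * n) -> e' * u * (p * n) <= e' * u * B ->
  3 * (e' * B) = e ->
  F + u * (p * (- 3 * r3)) - e * u <= F - 3 * p * (r1 - r2).
Proof. by move=> H1 H2 <-; lra. Qed.

Lemma oscillation_combination {R : realType} (F p e e' B r1 r2 n : R) :
  p * (r1 - r2) <= p * (e' * n) -> e' * (p * n) <= e' * B -> 3 * (e' * B) = e ->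
  F - e <= F - 3 * p * (r1 - r2).
Proof. by move=> H1 H2 <-; lra. Qed.

(** * The Lyapunov function *)

Section lyapunov.
Context {R : realType}.
Variables (beta h : R) (eta : nat -> R) (N : nat).
Hypothesis beta_gt0 : 0 < beta.
Hypothesis etaP : forall j, eta j = 1 \/ eta j = -1.
Hypothesis N_gt0 : (0 < N)%N.
Variables ym yq yl : R -> R.
Hypothesis ym_ode : forall t : R, 0 <= t -> is_derive t 1 ym (drift_m h (ym t) (yl t)).
Hypothesis yq_ode : forall t : R, 0 <= t -> is_derive t 1 yq (drift_q h (yq t) (yl t)).
Hypothesis yl_ode : forall t : R, 0 <= t -> is_derive t 1 yl (drift_l beta h (ym t) (yl t)).
Implicit Types (s : config N) (t l : R).

                                                                                 
                                                                                   
(** The growth rate found in [generator_sqdist_le]; the factor [weight] compensates for it, as in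
    Gronwall's lemma. *)
Let kappa : R := 6 * beta + 1.
Let kappa_gt0 : 0 < kappa. Proof. by rewrite addr_gt0 ?mulr_gt0. Qed.

Let weight t : R := expR (- (kappa * t)).
Let weight_gt0 t : 0 < weight t. Proof. exact: expR_gt0. Qed.

Let dist2 t s l := sqdist eta (ym t) (yq t) (yl t) s l.
Let dist2_ge0 t s l : 0 <= dist2 t s l.
Proof. by rewrite !addr_ge0 ?sqr_ge0. Qed.

Definition scaled_dist t s l : R := weight t * dist2 t s l.

Definition scaled_dist_dt t s l : R := weight t *
  (- kappa * dist2 t s l
   - 2 * (magn s - ym t) * drift_m h (ym t) (yl t)
   - 2 * (stag eta s - yq t) * drift_q h (yq t) (yl t)
   - 2 * (l - yl t) * drift_l beta h (ym t) (yl t)).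

                                                                          
                                                             
(** It equals 1 exactly on the limit path and 0 far from it. The exponent is 3 because the time
    derivative, which carries a square, must also be C^1 and thus belong to the domain. *)
Definition lyapunov t (x : config N * R) : R :=
  pos_part (1 - scaled_dist t x.1 x.2) ^+ 3.

Definition lyapunov_dt t (x : config N * R) : R :=
  pos_part (1 - scaled_dist t x.1 x.2) ^+ 2 * (- 3 * scaled_dist_dt t x.1 x.2).

Lemma scaled_dist_ge0 t s l : 0 <= scaled_dist t s l.
Proof. by rewrite mulr_ge0// ltW. Qed.

Lemma lyapunov_ge0 t x : 0 <= lyapunov t x.
Proof. by rewrite exprn_ge0// pos_part_ge0. Qed.

Let pos_part_le1 t s l : pos_part (1 - scaled_dist t s l) <= 1.
Proof. by rewrite /pos_part ge_max ler01 andbT gerBl scaled_dist_ge0. Qed.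

Lemma lyapunov_le1 t x : lyapunov t x <= 1.
Proof. by rewrite exprn_ile1 ?pos_part_ge0. Qed.

Let is_derive_shifted (c l : R) : is_derive l 1 (fun l => l - c) 1.
Proof.
rewrite -[X in is_derive _ _ _ X]subr0; apply: is_derive_sub.
Qed.

Let is_derive_dist2 t s l : is_derive l 1 (dist2 t s) (2 * (l - yl t)).
Proof.
rewrite /dist2 /sqdist -[X in is_derive _ _ _ X]add0r; apply: is_derive_add.
apply: (is_derive_eq (is_derive_exp 2 (is_derive_shifted (yl t) l))).
by rewrite /= expr1 mulr1.
Qed.

Let is_derive_scaled_dist t s l :
  is_derive l 1 (scaled_dist t s) (weight t * (2 * (l - yl t))).
Proof.
have := is_derive_mul (is_derive_cst (weight t) l 1) (is_derive_dist2 t s l).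
by rewrite mul0r add0r.
Qed.

Let continuous_affine (a b : R) : continuous (fun l : R => a * (l - b)).
Proof.
by move=> l; apply: cvgM; [exact: cvg_cst|apply: cvgB; [exact: cvg_id|exact: cvg_cst]].
Qed.

Let scaled_dist_large t s : exists K : R, forall l, K < `|l| -> 1 <= scaled_dist t s l.
Proof.
(* Beyond this value l is at distance at least 1 + 1/weight from [yl t], and the square of that
   exceeds 1/weight. *)
exists (`|yl t| + 1 + (weight t)^-1) => l lK.
have w0 := weight_gt0 t; have wi0 : 0 < (weight t)^-1 by rewrite invr_gt0.
have d1 : 1 + (weight t)^-1 <= `|l - yl t|.
  by have := lerB_dist l (yl t); lra.
have d2 : (weight t)^-1 <= (l - yl t) ^+ 2.
  by rewrite -[_ ^+ 2]real_normK ?num_real//; nra.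
have d3 : (weight t)^-1 <= dist2 t s l.
  by rewrite /dist2 /sqdist; have := sqr_ge0 (magn s - ym t);
    have := sqr_ge0 (stag eta s - yq t); lra.
by rewrite -(divff (lt0r_neq0 w0)) ler_pM2l.
Qed.

Lemma lyapunov_micro_domain t : micro_domain (lyapunov t) /\
  forall s l, derive1 (fun l' => lyapunov t (s, l')) l =
    - 3 * pos_part (1 - scaled_dist t s l) ^+ 2 * (weight t * (2 * (l - yl t))).
Proof.
have [|s|s|s|D dE] := @capped_micro_domain _ N 1 (scaled_dist t) (fun _ _ => 1)
  (fun _ l => weight t * (2 * (l - yl t))) (fun _ _ => 0).
- by move=> s l; exact: is_derive_scaled_dist.
- by move=> l; apply: cvgM; [exact: cvg_cst|exact: continuous_affine].
- exact: cst_continuous.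
- exact: scaled_dist_large.
have lE : lyapunov t = (fun x => pos_part (1 - scaled_dist t x.1 x.2) ^+ 3 * 1).
  by apply/funext => x; rewrite mulr1.
split=> [|s l]; first by rewrite lE.
rewrite lE dE; ring.
Qed.

Lemma lyapunov_dt_micro_domain t : micro_domain (lyapunov_dt t).
Proof.
have [||s|s|s|D _] := @capped_micro_domain _ N 0 (scaled_dist t)
  (fun s l => - 3 * scaled_dist_dt t s l)
  (fun _ l => weight t * (2 * (l - yl t)))
  (fun _ l => - 3 * (weight t * (- kappa * (2 * (l - yl t))
     - 2 * drift_l beta h (ym t) (yl t)))).
- by move=> s l; exact: is_derive_scaled_dist.
- move=> s l; rewrite /scaled_dist_dt.
  have d2 := is_derive_dist2 t s l; have d1 := is_derive_shifted (yl t) l.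
  have dk := is_derive_mul (is_derive_cst (- kappa) l 1) d2.
  pose c1 := 2 * (magn s - ym t) * drift_m h (ym t) (yl t).
  pose c2 := 2 * (stag eta s - yq t) * drift_q h (yq t) (yl t).
  have ds := is_derive_sub (is_derive_sub dk (is_derive_cst c1 l 1)) (is_derive_cst c2 l 1).
  have dl := is_derive_mul (is_derive_mul (is_derive_cst (2 : R) l 1) d1)
    (is_derive_cst (drift_l beta h (ym t) (yl t)) l 1).
  have dw := is_derive_mul (is_derive_cst (weight t) l 1) (is_derive_sub ds dl).
  apply: (is_derive_eq (is_derive_mul (is_derive_cst (- 3 : R) l 1) dw)).
  by rewrite /cst /=; ring.
- by move=> l; apply: cvgM; [exact: cvg_cst|exact: continuous_affine].
- move=> l; apply: cvgM; first exact: cvg_cst.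
  apply: cvgM; first exact: cvg_cst.
  apply: cvgB; last exact: cvg_cst.
  by apply: cvgM; [exact: cvg_cst|exact: continuous_affine].
- exact: scaled_dist_large.
- exact: D.
Qed.

(** The remainder of [generator_sqdist_le] times 3, the largest slope of the cube on [0, 1]. *)
Definition drift_error : R :=
  3 * (4 * (2 + beta ^+ 2) * eta_mean eta N ^+ 2 + 8 * (2 + beta ^+ 2) / N%:R).

Lemma drift_error_ge0 : 0 <= drift_error.
Proof.
have b2 := sqr_ge0 beta; have e2 := sqr_ge0 (eta_mean eta N).
rewrite mulr_ge0// addr_ge0//; first by rewrite mulr_ge0//; lra.
by rewrite divr_ge0//; lra.
Qed.

                                                                      
                                                                    
(** Let p be the positive part at x. By convexity the left-hand side of the drift inequality enters
    as -3 p^2 weight (L V + dV/dt - kappa V), and both p^2 and [weight] are at most 1. *)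
Lemma generator_lyapunov t : 0 <= t -> forall x,
  - drift_error <= micro_generator beta h eta (lyapunov t) x + lyapunov_dt t x.
Proof.
move=> t0 [s l].
have [_ dE] := lyapunov_micro_domain t.
rewrite /micro_generator dE /lyapunov_dt /=.
set p := pos_part _.
have p2 : 0 <= p ^+ 2 by rewrite sqr_ge0.
have p21 : p ^+ 2 <= 1 by rewrite exprn_ile1 ?pos_part_ge0 ?pos_part_le1.
pose l' j := l - 2 * beta * spin (s j) / N%:R.
have jump : - 3 * p ^+ 2 * weight t *
    (\sum_(j < N) rate h eta s l j * (dist2 t (flip s j) (l' j) - dist2 t s l)) <=
    \sum_(j < N) (1 - spin (s j) * tanh (l + h * eta j)) *
      (lyapunov t (flip s j, l' j) - lyapunov t (s, l)).
  rewrite mulr_sumr; apply: ler_sum => j _.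
  rewrite -/(rate h eta s l j) mulrCA; apply: ler_wpM2l.
    by case/andP: (rate_bounds h eta s l j).
  have := pos_part_cube_convex (1 - scaled_dist t s l) (1 - scaled_dist t (flip s j) (l' j)).
  by rewrite /lyapunov /= -/p /scaled_dist; lra.
pose J := \sum_(j < N) rate h eta s l j * (dist2 t (flip s j) (l' j) - dist2 t s l).
pose a1 := 2 * (magn s - ym t) * drift_m h (ym t) (yl t).
pose a2 := 2 * (stag eta s - yq t) * drift_q h (yq t) (yl t).
pose a3 := 2 * (l - yl t) * drift_l beta h (ym t) (yl t).
pose E := 4 * (2 + beta ^+ 2) * eta_mean eta N ^+ 2 + 8 * (2 + beta ^+ 2) / N%:R.
have drift : J - l * (2 * (l - yl t)) - a1 - a2 - a3 <= kappa * dist2 t s l + E.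
  exact: (@generator_sqdist_le _ beta h eta N beta_gt0 etaP N_gt0 (ym t) (yq t) (yl t) s l).
have w1 : weight t <= 1 by rewrite -[leRHS]expR0 ler_expR oppr_le0 mulr_ge0// ltW.
have w0 := weight_gt0 t.
have E0 : 0 <= E by have := drift_error_ge0; rewrite /drift_error -/E; lra.
apply: le_trans (lerD (lerB jump (lexx _)) (lexx _)).
rewrite /scaled_dist_dt -/a1 -/a2 -/a3 -/J /drift_error -/E.
move: drift; move: (J) (a1) (a2) (a3) (E) (dist2 t s l) E0 => {}J {}a1 {}a2 {}a3 {}E D E0 drift.
have {}drift : J - l * (2 * (l - yl t)) - a1 - a2 - a3 - kappa * D <= E by lra.
have pw0 : 0 <= p ^+ 2 * weight t by rewrite mulr_ge0// ltW.
have pw1 : p ^+ 2 * weight t <= 1 by rewrite mulr_ile1// ltW.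
have H1 : p ^+ 2 * weight t * (J - l * (2 * (l - yl t)) - a1 - a2 - a3 - kappa * D) <=
  p ^+ 2 * weight t * E by rewrite ler_wpM2l.
have H2 : p ^+ 2 * weight t * E <= E by rewrite ler_piMl.
lra.
Qed.

Let sqnorm s l : R := magn s ^+ 2 + stag eta s ^+ 2 + l ^+ 2.

(** The scaled distance is of this form with coefficients depending on time only, so expansions in
    time that are uniform in the state reduce to five scalar functions. *)
Let quadratic (e0 e1 e2 e3 e4 : R) s l : R :=
  e0 * sqnorm s l + e1 * magn s + e2 * stag eta s + e3 * l + e4.

Let coef_m t : R := weight t * ym t.
Let coef_q t : R := weight t * yq t.
Let coef_l t : R := weight t * yl t.
Let coef_1 t : R := weight t * (ym t ^+ 2 + yq t ^+ 2 + yl t ^+ 2).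

Let scaled_distE t s l : scaled_dist t s l =
  quadratic (weight t) (- 2 * coef_m t) (- 2 * coef_q t) (- 2 * coef_l t) (coef_1 t) s l.
Proof.
by rewrite /scaled_dist /dist2 /sqdist /quadratic /sqnorm /coef_m /coef_q /coef_l /coef_1; ring.
Qed.

Let quadratic_norm_le (e e0 e1 e2 e3 e4 : R) s l :
  `|e0| <= e -> `|e1| <= e -> `|e2| <= e -> `|e3| <= e -> `|e4| <= e ->
  `|quadratic e0 (- 2 * e1) (- 2 * e2) (- 2 * e3) e4 s l| <= e * (2 * sqnorm s l + 4).
Proof.
move=> h0 h1 h2 h3 h4.
have ab (x y : R) : `|x| <= e -> `|- 2 * x * y| <= e * (1 + y ^+ 2).
  move=> xe; have -> : `|- 2 * x * y| = 2 * `|x| * `|y|.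
    by rewrite !normrM normrN [X in X * _ * _]ger0_norm.
  have : 2 * `|y| <= 1 + y ^+ 2.
    by have := sqr_ge0 (`|y| - 1); rewrite sqrrB real_normK ?num_real// expr1n; lra.
  have y0 := normr_ge0 y; have x0 := normr_ge0 x; nra.
have H0 : `|e0 * sqnorm s l| <= e * sqnorm s l.
  have n0 : 0 <= sqnorm s l by rewrite !addr_ge0 ?sqr_ge0.
  by rewrite normrM (ger0_norm n0) ler_wpM2r.
have H1 := ab _ (magn s) h1; have H2 := ab _ (stag eta s) h2; have H3 := ab _ l h3.
rewrite /quadratic; do 4 (apply: (le_trans (ler_normD _ _)); rewrite -lerBrDr).
move: H0 H1 H2 H3 h4; rewrite /sqnorm => *; lra.
Qed.

Let is_derive_weight t : is_derive t 1 weight (- kappa * weight t).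
Proof.
have dk : is_derive t 1 (fun t => - (kappa * t)) (- (0 * t + kappa * 1)).
  apply: is_derive_opp; exact: (is_derive_mul (is_derive_cst kappa t 1) (is_derive_id t 1)).
have := @is_derive_comp R expR (fun t => - (kappa * t)) t _ _ (is_derive_expR _) dk.
by move=> H; apply: (is_derive_eq H); rewrite mul0r add0r mulr1 mulrC.
Qed.

Let ym' t : R := drift_m h (ym t) (yl t).
Let yq' t : R := drift_q h (yq t) (yl t).
Let yl' t : R := drift_l beta h (ym t) (yl t).

Let is_derive_coef t (y : R -> R) y' : is_derive t 1 y y' ->
  is_derive t 1 (fun t => weight t * y t) (- kappa * weight t * y t + weight t * y').
Proof. exact: is_derive_mul (is_derive_weight t). Qed.

Let is_derive_coef1 t : 0 <= t -> is_derive t 1 coef_1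
  (- kappa * weight t * (ym t ^+ 2 + yq t ^+ 2 + yl t ^+ 2) +
   weight t * (2 * ym t * ym' t + 2 * yq t * yq' t + 2 * yl t * yl' t)).
Proof.
move=> t0; apply: is_derive_coef; apply: is_derive_add; first apply: is_derive_add.
- by have := is_derive_exp 2 (ym_ode t0); rewrite /= expr1.
- by have := is_derive_exp 2 (yq_ode t0); rewrite /= expr1.
- by have := is_derive_exp 2 (yl_ode t0); rewrite /= expr1.
Qed.

Let scaled_dist_dtE t s l : scaled_dist_dt t s l =
  quadratic (- kappa * weight t)
    (- 2 * (- kappa * weight t * ym t + weight t * ym' t))
    (- 2 * (- kappa * weight t * yq t + weight t * yq' t))
    (- 2 * (- kappa * weight t * yl t + weight t * yl' t))
    (- kappa * weight t * (ym t ^+ 2 + yq t ^+ 2 + yl t ^+ 2) +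
     weight t * (2 * ym t * ym' t + 2 * yq t * yq' t + 2 * yl t * yl' t)) s l.
Proof.
rewrite /scaled_dist_dt /dist2 /sqdist /quadratic /sqnorm -/(ym' t) -/(yq' t) -/(yl' t).
by ring.
Qed.

Let ynorm t : R := ym t ^+ 2 + yq t ^+ 2 + yl t ^+ 2.

Let sqnorm_bound t s l : scaled_dist t s l < 1 ->
  sqnorm s l <= 2 * (weight t)^-1 + 2 * ynorm t.
Proof.
rewrite /scaled_dist -ltr_pdivlMl// mulr1 => /ltW.
rewrite /dist2 /sqdist /sqnorm /ynorm.
have ab (x y : R) : x ^+ 2 <= 2 * (x - y) ^+ 2 + 2 * y ^+ 2.
  by have := sqr_ge0 (x - 2 * y); rewrite !sqrrB; lra.
have := ab (magn s) (ym t); have := ab (stag eta s) (yq t); have := ab l (yl t).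
by move: (_^-1) => *; lra.
Qed.

Let lyapunov_slope t t' s l : lyapunov t (s, l) -
    3 * pos_part (1 - scaled_dist t s l) ^+ 2 * (scaled_dist t' s l - scaled_dist t s l) <=
  lyapunov t' (s, l).
Proof.
have := pos_part_cube_convex (1 - scaled_dist t s l) (1 - scaled_dist t' s l).
by rewrite /lyapunov /=; lra.
Qed.

(** The slope vanishes off the support, so a quantity that grows with the state only has to be
    bounded where the scaled distance is below 1. *)
Let slope_bound t s l (B d : R) : 0 <= d -> (scaled_dist t s l < 1 -> d <= B) ->
  0 <= B -> pos_part (1 - scaled_dist t s l) ^+ 2 * d <= B.
Proof.
move=> d0 dB B0; have [r1|r1] := ltP (scaled_dist t s l) 1.
  apply: le_trans (dB r1); rewrite ler_piMl// exprn_ile1 ?pos_part_ge0//.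
by rewrite pos_part_neg ?subr_le0// expr0n mul0r.
Qed.

Let ynorm_ge0 t : 0 <= ynorm t. Proof. by rewrite !addr_ge0 ?sqr_ge0. Qed.

(** After the tangent-line inequality, the error is the slope at time t times the error in expanding
    the scaled distance. The latter is quadratic in the state, and the state is bounded where the
    slope is nonzero. *)
Lemma lyapunov_right_derivative t : 0 <= t -> forall e : R, 0 < e ->
  \forall u \near 0^'+, forall x : config N * R,
    lyapunov t x + u * lyapunov_dt t x - e * u <= lyapunov (t + u) x.
Proof.
move=> t0 e e0.
(* Bounds 2 [sqnorm] + 4 on the support, by [sqnorm_bound]. *)
pose B := 2 * (2 * (weight t)^-1 + 2 * ynorm t) + 4.
have wi0 : 0 < (weight t)^-1 by rewrite invr_gt0.
have B0 : 0 < B by have := ynorm_ge0 t; rewrite /B; lra.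
pose e' := e / (3 * B).
have e'0 : 0 < e' by rewrite divr_gt0// mulr_gt0.
have e'B : 3 * (e' * B) = e by rewrite /e'; field; exact: lt0r_neq0.
near=> u => -[s l].
have u0 : 0 < u by near: u; exact: nbhs_right_gt.
have H0 : `|weight (t + u) - weight t - u * (- kappa * weight t)| <= e' * u.
  by near: u; apply: is_derive_affine_approx e'0; exact: is_derive_weight.
have H1 : `|coef_m (t + u) - coef_m t - u * (- kappa * weight t * ym t + weight t * ym' t)| <= e' * u.
  by near: u; apply: is_derive_affine_approx e'0; apply: is_derive_coef; exact: ym_ode.
have H2 : `|coef_q (t + u) - coef_q t - u * (- kappa * weight t * yq t + weight t * yq' t)| <= e' * u.
  by near: u; apply: is_derive_affine_approx e'0; apply: is_derive_coef; exact: yq_ode.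
have H3 : `|coef_l (t + u) - coef_l t - u * (- kappa * weight t * yl t + weight t * yl' t)| <= e' * u.
  by near: u; apply: is_derive_affine_approx e'0; apply: is_derive_coef; exact: yl_ode.
have H4 : `|coef_1 (t + u) - coef_1 t - u * (- kappa * weight t * (ym t ^+ 2 + yq t ^+ 2 + yl t ^+ 2) +
     weight t * (2 * ym t * ym' t + 2 * yq t * yq' t + 2 * yl t * yl' t))| <= e' * u.
  by near: u; apply: is_derive_affine_approx e'0; exact: is_derive_coef1.
have := quadratic_norm_le s l H0 H1 H2 H3 H4.
set q := quadratic _ _ _ _ _ _ _.
have qE : q = scaled_dist (t + u) s l - scaled_dist t s l - u * scaled_dist_dt t s l.
  by rewrite /q !scaled_distE scaled_dist_dtE /quadratic; ring.
rewrite qE => /(le_trans (ler_norm _)) H.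
apply: le_trans (lyapunov_slope t (t + u) s l).
rewrite /lyapunov_dt /=.
have sn0 : 0 <= sqnorm s l by rewrite !addr_ge0 ?sqr_ge0.
have n0 : 0 <= 2 * sqnorm s l + 4 by rewrite addr_ge0 ?mulr_ge0.
have slope : pos_part (1 - scaled_dist t s l) ^+ 2 * (2 * sqnorm s l + 4) <= B.
  apply: slope_bound (ltW B0) => // r1; rewrite /B lerD2r ler_pM2l//.
  exact: sqnorm_bound.
have p2 : 0 <= pos_part (1 - scaled_dist t s l) ^+ 2 by rewrite sqr_ge0.
move: slope p2 H; move: (pos_part _ ^+ 2) => p slope p2 H.
have {H} := ler_wpM2l p2 H.
have {slope} : e' * u * (p * (2 * sqnorm s l + 4)) <= e' * u * B.
  by rewrite ler_wpM2l// mulr_ge0// ltW.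
by move=> slope H; exact: slope_combination H slope e'B.
Unshelve. all: by end_near. Qed.

Lemma lyapunov_left_continuous t : 0 < t -> forall e : R, 0 < e ->
  \forall u \near 0^'+, forall x : config N * R,
    lyapunov (t - u) x - e <= lyapunov t x.
Proof.
move=> t0 e e0.
(* The tangent line is now taken at time t - u, so the bound must hold there: 1/weight is smaller at
   t - u, and [ynorm] changes by at most 1. *)
pose B := 2 * (2 * (weight t)^-1 + 2 * (ynorm t + 1)) + 4.
have wi0 : 0 < (weight t)^-1 by rewrite invr_gt0.
have B0 : 0 < B by have := ynorm_ge0 t; rewrite /B; lra.
pose e' := e / (3 * B).
have e'0 : 0 < e' by rewrite divr_gt0// mulr_gt0.
have e'B : 3 * (e' * B) = e by rewrite /e'; field; exact: lt0r_neq0.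
have left_limit (k : R -> R) dk : is_derive t 1 k dk -> k (t - u) @[u --> 0^'+] --> k t.
  move=> /is_derive_continuous ck.
  have ct : t - u @[u --> (0:R)^'+] --> t.
    apply: cvg_at_right_filter; rewrite -[X in _ --> X]subr0.
    by apply: cvgB; [exact: cvg_cst|exact: cvg_id].
  exact: (continuous_cvg _ ck ct).
have near_left (k : R -> R) dk : is_derive t 1 k dk -> forall d, 0 < d ->
    \forall u \near 0^'+, `|k t - k (t - u)| <= d.
  by move=> /left_limit/cvgrPdist_le.
have t0' := ltW t0.
have dynorm : is_derive t 1 ynorm
    (2%:R * ym t ^+ 1 * ym' t + 2%:R * yq t ^+ 1 * yq' t + 2%:R * yl t ^+ 1 * yl' t).
  by apply: is_derive_add; [apply: is_derive_add|]; apply: is_derive_exp;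
    [exact: ym_ode|exact: yq_ode|exact: yl_ode].
near=> u => -[s l].
have u0 : 0 < u by near: u; exact: nbhs_right_gt.
have H0 : `|weight t - weight (t - u)| <= e'.
  by near: u; exact: (near_left weight _ (is_derive_weight t) _ e'0).
have H1 : `|coef_m t - coef_m (t - u)| <= e'.
  by near: u; exact: (near_left coef_m _ (is_derive_coef (ym_ode t0')) _ e'0).
have H2 : `|coef_q t - coef_q (t - u)| <= e'.
  by near: u; exact: (near_left coef_q _ (is_derive_coef (yq_ode t0')) _ e'0).
have H3 : `|coef_l t - coef_l (t - u)| <= e'.
  by near: u; exact: (near_left coef_l _ (is_derive_coef (yl_ode t0')) _ e'0).
have H4 : `|coef_1 t - coef_1 (t - u)| <= e'.
  by near: u; exact: (near_left coef_1 _ (is_derive_coef1 t0') _ e'0).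
have H5 : `|ynorm t - ynorm (t - u)| <= 1.
  by near: u; exact: (near_left ynorm _ dynorm _ ltr01).
have := quadratic_norm_le s l H0 H1 H2 H3 H4.
set q := quadratic _ _ _ _ _ _ _.
have qE : q = scaled_dist t s l - scaled_dist (t - u) s l.
  by rewrite /q !scaled_distE /quadratic; ring.
rewrite qE => /(le_trans (ler_norm _)) H.
apply: le_trans (lyapunov_slope (t - u) t s l).
have sn0 : 0 <= sqnorm s l by rewrite !addr_ge0 ?sqr_ge0.
have n0 : 0 <= 2 * sqnorm s l + 4 by rewrite addr_ge0 ?mulr_ge0.
have slope : pos_part (1 - scaled_dist (t - u) s l) ^+ 2 * (2 * sqnorm s l + 4) <= B.
  apply: slope_bound (ltW B0) => // /sqnorm_bound r1; rewrite /B lerD2r ler_pM2l//.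
  apply: (le_trans r1); apply: lerD; rewrite ler_pM2l//.
    rewrite lef_pV2 ?posrE// ler_expR lerN2 ler_pM2l//; lra.
  by move: H5; rewrite ler_norml => /andP[? ?]; lra.
have p2 : 0 <= pos_part (1 - scaled_dist (t - u) s l) ^+ 2 by rewrite sqr_ge0.
move: slope p2 H; move: (pos_part _ ^+ 2) => p slope p2 H.
have {H} := ler_wpM2l p2 H.
have {slope} : e' * (p * (2 * sqnorm s l + 4)) <= e' * B by rewrite ler_pM2l.
by move=> slope H; exact: oscillation_combination H slope e'B.
Unshelve. all: by end_near. Qed.

End lyapunov.

                                                 

(** * From uniform closeness in probability to weak convergence *)

Section nonmeasurable_integrands.
Context {R : realType} {d : measure_display} {T : measurableType d}.
Variable mu : probability T R.
Local Open Scope ereal_scope.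

                                                                         
                                                                      
(** The integral of a nonnegative function is a supremum over the simple functions below it, so
    monotonicity holds without measurability. Test functionals of paths can then be integrated
    without proving them measurable. *)
Lemma ge0_le_integral_nonmeasurable (f g : T -> \bar R) :
  (forall x, 0 <= f x) -> (forall x, f x <= g x) ->
  \int[mu]_x f x <= \int[mu]_x g x.
Proof.
move=> f0 fg; have g0 x : 0 <= g x by exact: le_trans (fg x).
rewrite !ge0_integralTE//; apply: le_ereal_sup => _ [k /= kf <-].
by exists k => //= x; exact: le_trans (kf x) (fg x).
Qed.

Lemma le_integral_nonmeasurable (f g : T -> \bar R) : (forall x, f x <= g x) ->
  \int[mu]_x f x <= \int[mu]_x g x.
Proof.
move=> fg; rewrite (integralE _ _ f) (integralE _ _ g); apply: leeB.
  apply: ge0_le_integral_nonmeasurable => x; first exact: funepos_ge0.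
  by rewrite !funeposE ge_max !le_max fg lexx orbT.
apply: ge0_le_integral_nonmeasurable => x; first exact: funeneg_ge0.
by rewrite !funenegE ge_max !le_max leeN2 fg lexx orbT.
Qed.

(** The function g is squeezed between c - e - 2M 1_A and c + e + 2M 1_A, whose integrals are
    explicit. *)
Lemma integral_concentration (g : T -> R) (A : set T) (M c e p : R) :
  measurable A -> mu A <= p%:E -> (0 <= e)%R -> (forall w, `|g w| <= M)%R -> (`|c| <= M)%R ->
  (forall w, ~ A w -> `|g w - c| <= e)%R ->
  exists I : R, \int[mu]_w (g w)%:E = I%:E /\ (`|I - c| <= e + 2 * M * p)%R.
Proof.
move=> mA muA e0 gM cM gc.
have mu1 : mu setT = 1 by exact: probability_setT.
have M0 : (0 <= M)%R by exact: le_trans (normr_ge0 c) cM.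
have b1 : bounded_measurable (\1_A : T -> R).
  split; first exact: measurable_indic.
  by exists 1%R => w; rewrite indicE; case: (_ \in _); rewrite ?normr1 ?normr0.
have bk (k b : R) : bounded_measurable (fun w => (k * \1_A w + b)%R).
  exact: bounded_measurableD (bounded_measurableZ k b1) (bounded_measurable_cst b).
have int1 : \int[mu]_w (\1_A w)%:E = mu A by rewrite integral_indic// setIT.
have /fineK muAE : mu A \is a fin_num by exact: fin_num_measure.
have R1 : (\int[mu]_w \1_A w = fine (mu A))%R by rewrite /Rintegral int1.
have intk (k b : R) : \int[mu]_w (k * \1_A w + b)%:E = (k * fine (mu A) + b)%:E.
  rewrite -(EFin_Rintegral_bounded mu1 (bk k b)).
  rewrite (Rintegral_boundedD mu1 (bounded_measurableZ k b1) (bounded_measurable_cst _)).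
  by rewrite (Rintegral_boundedZ mu1 _ b1) (Rintegral_bounded_cst mu1) R1.
have lo : (- (2 * M) * fine (mu A) + (c - e))%:E <= \int[mu]_w (g w)%:E.
  rewrite -intk; apply: le_integral_nonmeasurable => w; rewrite lee_fin indicE.
  move: (gM w) cM; rewrite !ler_norml => /andP[? ?] /andP[? ?].
  have [Aw|Aw] := boolP (w \in A); first by rewrite /=; lra.
  have : (`|g w - c| <= e)%R by apply: gc => Aw'; move/negP: Aw; apply; rewrite inE.
  by rewrite ler_norml => /andP[? ?]; rewrite /=; lra.
have hi : \int[mu]_w (g w)%:E <= (2 * M * fine (mu A) + (c + e))%:E.
  rewrite -intk; apply: le_integral_nonmeasurable => w; rewrite lee_fin indicE.
  move: (gM w) cM; rewrite !ler_norml => /andP[? ?] /andP[? ?].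
  have [Aw|Aw] := boolP (w \in A); first by rewrite /=; lra.
  have : (`|g w - c| <= e)%R by apply: gc => Aw'; move/negP: Aw; apply; rewrite inE.
  by rewrite ler_norml => /andP[? ?]; rewrite /=; lra.
exists (fine (\int[mu]_w (g w)%:E)).
have fin : \int[mu]_w (g w)%:E \is a fin_num.
  by rewrite fin_real// (lt_le_trans (ltNyr _) lo) (le_lt_trans hi (ltry _)).
rewrite fineK//; split => //.
move: lo hi; rewrite -(fineK fin) !lee_fin => lo hi.
have pA : (2 * M * fine (mu A) <= 2 * M * p)%R.
  by rewrite ler_wpM2l ?mulr_ge0// -lee_fin muAE.
by rewrite ler_norml; apply/andP; split; lra.
Qed.

End nonmeasurable_integrands.

Section skorokhod_convergence.
Context {R : realType} {E : pseudoMetricType R}.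

Lemma nbhs_skorokhod_ball (x : cadlag R E) (A : set (cadlag R E)) :
  nbhs x A -> exists T e : R, 0 < e /\ skorokhod_ball x T e `<=` A.
Proof.
rewrite nbhsE => -[U [oU Ux] UA].
have [T [e [e0 H]]] : exists T e : R, 0 < e /\ skorokhod_ball x T e `<=` U by exact: oU.
by exists T, e; split => // z /H /UA.
Qed.

Lemma skorokhod_ball_uniform (x z : cadlag R E) (T e : R) : 0 < e ->
  (forall t, 0 <= t <= T -> ball (x t) e (z t)) -> skorokhod_ball x T e z.
Proof.
move=> e0 xz; exists id; split; last by move=> t tT; rewrite subrr normr0; split; [|exact: xz].
by split=> [//|]; rewrite image_id.
Qed.

                                                                              
                    
(** Uniform closeness on [0, tau] is Skorokhod closeness with the identity time change. As the limit
    is a constant, continuity of F at y and boundedness of F suffice. *)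
Lemma weakly_cvg_cst_skorokhod {d : nat -> measure_display}
    {T : forall N, measurableType (d N)} (Q : forall N, probability (T N) R)
    (Y : forall N, T N -> cadlag R E) (y : cadlag R E) :
  (forall (tau : nat) (e p : R), 0 < e -> 0 < p -> \forall N \near \oo,
     exists2 A : set (T N), measurable A & (Q N A <= p%:E)%E /\
       forall w, ~ A w -> forall t, 0 <= t <= tau%:R -> ball (y t) e (Y N w t)) ->
  weakly_cvg_cst Q Y y.
Proof.
move=> H F cF [M0 [_ bF]].
pose M := `|M0| + 1.
have M0lt : M0 < M by rewrite /M (le_lt_trans (ler_norm M0))// ltrDl.
have M_gt0 : 0 < M by rewrite /M ltr_wpDl.
have FM x : `|F x| <= M by exact: (bF M M0lt x).
have finI N : exists I : R, (\int[Q N]_w (F (Y N w))%:E)%E = I%:E.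
  (* With an empty exceptional set and centre 0, this only says that the integral is finite. *)
  have [||||||I [IE _]] := @integral_concentration _ _ _ (Q N) (fun w => F (Y N w)) set0 M 0 M 0.
  - exact: measurable0.
  - by rewrite measure0.
  - exact: ltW.
  - by move=> w; exact: FM.
  - by rewrite normr0 ltW.
  - by move=> w _; rewrite subr0.
  by exists I.
have /choice[I IE] := finI.
under eq_fun do rewrite IE.
apply: cvg_EFin; first exact: nearW.
apply/cvgrPdist_le => e e0.
have /cvgrPdist_lt/(_ (e / 2) ltac:(lra)) := cF y.
move=> /nbhs_skorokhod_ball[tau [r [r0 ballF]]].
pose n := (Num.truncn `|tau|).+1.
have ntau : tau <= n%:R.
  by apply: (le_trans (ler_norm _)); apply: ltW; exact: truncnS_gt.
(* This probability contributes 2 M e / (4 M) = e / 2; the oscillation of F contributes the other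
   half. *)
have p0 : 0 < e / (4 * M) by rewrite divr_gt0// mulr_gt0.
have := H n r _ r0 p0; apply: filterS => N [A mA [QA HA]].
have [||||||I' [I'E I'P]] := @integral_concentration _ _ _ (Q N) (fun w => F (Y N w)) A M
  (F y) (e / 2) (e / (4 * M)).
- exact: mA.
- exact: QA.
- by lra.
- by move=> w; exact: FM.
- exact: FM.
- move=> w nA; rewrite distrC; apply/ltW/ballF; apply: skorokhod_ball_uniform => // t /andP[t0 tT].
  by apply: HA => //; rewrite t0 (le_trans tT).
move: I'E; rewrite IE => -[IN]; rewrite /= IN distrC; apply: (le_trans I'P).
have -> : 2 * M * (e / (4 * M)) = e / 2 by field; exact: lt0r_neq0.
by lra.
Qed.

End skorokhod_convergence.

                                            

(** * The limit equations and the convergence theorem *)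

Section limit_solution.
Context {R : realType}.
Variables beta h : R.
Hypothesis beta_gt0 : 0 < beta.

Lemma limit_ode_exists (m0 q0 l0 : R) : exists ym yq yl : R -> R,
  [/\ ym 0 = m0, yq 0 = q0 & yl 0 = l0] /\
  [/\ forall t : R, 0 <= t -> is_derive t 1 ym (drift_m h (ym t) (yl t)),
      forall t : R, 0 <= t -> is_derive t 1 yq (drift_q h (yq t) (yl t)) &
      forall t : R, 0 <= t -> is_derive t 1 yl (drift_l beta h (ym t) (yl t))].
Proof.
pose i0 := @Ordinal 3 0 isT; pose i1 := @Ordinal 3 1 isT; pose i2 := @Ordinal 3 2 isT.
pose F (x : 'I_3 -> R) (i : 'I_3) : R :=
  if val i == 0%N then drift_m h (x i0) (x i2)
  else if val i == 1%N then drift_q h (x i1) (x i2) else drift_l beta h (x i0) (x i2).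
(* The m and q components have Lipschitz constant 4, the lambda component 1 + 4 beta. *)
pose L := 4 + 4 * beta.
have L0 : 0 <= L by rewrite addr_ge0// mulr_ge0// ltW.
have F_lip (x y : 'I_3 -> R) i : `|F x i - F y i| <= L * \sum_j `|x j - y j|.
  set S := \sum_j _.
  have le_S j : `|x j - y j| <= S by rewrite /S (bigD1 j)//= lerDl sumr_ge0.
  have S0 := le_trans (normr_ge0 _) (le_S i0).
  have bS : 0 <= beta * S by rewrite mulr_ge0// ltW.
  have tp : `|tanh (x i2 + h) - tanh (y i2 + h)| <= S.
    apply: (le_trans (tanh_lipschitz _ _)); apply: le_trans (le_S i2).
    by rewrite (_ : _ - _ = x i2 - y i2)//; ring.
  have tm : `|tanh (x i2 - h) - tanh (y i2 - h)| <= S.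
    apply: (le_trans (tanh_lipschitz _ _)); apply: le_trans (le_S i2).
    by rewrite (_ : _ - _ = x i2 - y i2)//; ring.
  have dm : `|drift_m h (x i0) (x i2) - drift_m h (y i0) (y i2)| <= 4 * S.
    move: tp tm (le_S i0); rewrite !ler_norml /drift_m => /andP[? ?] /andP[? ?] /andP[? ?].
    by apply/andP; split; lra.
  rewrite /F /L; case: ifP => _; last case: ifP => _.
  - by apply: (le_trans dm); lra.
  - move: tp tm (le_S i1); rewrite !ler_norml /drift_q => /andP[? ?] /andP[? ?] /andP[? ?].
    by apply/andP; split; lra.
  - have bdm : `|beta * (drift_m h (x i0) (x i2) - drift_m h (y i0) (y i2))| <= beta * (4 * S).
      by rewrite normrM gtr0_norm// ler_pM2l.
    move: bdm (le_S i2); rewrite !ler_norml /drift_l => /andP[? ?] /andP[? ?].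
    by apply/andP; split; lra.
have [z [z0 _ dz]] := global_ode_solution L0 F_lip
  (fun i => if val i == 0%N then m0 else if val i == 1%N then q0 else l0).
exists (z i0), (z i1), (z i2); split; first by split; rewrite z0.
by split => t t0; [exact: (dz t t0 i0)|exact: (dz t t0 i1)|exact: (dz t t0 i2)].
Qed.

(** By the one-sided Lipschitz estimate, e^(-6 beta t) times the squared distance between the two
    solutions is nonincreasing on [0, T], and it starts from 0. *)
Lemma limit_ode_unique (ym yq yl zm zq zl : R -> R) (T : R) :
  [/\ ym 0 = zm 0, yq 0 = zq 0 & yl 0 = zl 0] ->
  [/\ ym t @[t --> (0:R)^'+] --> ym 0, yq t @[t --> (0:R)^'+] --> yq 0 & yl t @[t --> (0:R)^'+] --> yl 0] ->
  [/\ zm t @[t --> (0:R)^'+] --> zm 0, zq t @[t --> (0:R)^'+] --> zq 0 & zl t @[t --> (0:R)^'+] --> zl 0] ->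
  (forall t : R, 0 < t -> [/\ is_derive t 1 ym (drift_m h (ym t) (yl t)),
      is_derive t 1 yq (drift_q h (yq t) (yl t)) &
      is_derive t 1 yl (drift_l beta h (ym t) (yl t))]) ->
  (forall t : R, 0 < t -> [/\ is_derive t 1 zm (drift_m h (zm t) (zl t)),
      is_derive t 1 zq (drift_q h (zq t) (zl t)) &
      is_derive t 1 zl (drift_l beta h (zm t) (zl t))]) ->
  0 <= T -> [/\ zm T = ym T, zq T = yq T & zl T = yl T].
Proof.
move=> [m0 q0 l0] [cym cyq cyl] [czm czq czl] dy dz.
rewrite le_eqVlt => /predU1P[<-|T0]; first by rewrite m0 q0 l0.
pose D t := (zm t - ym t) ^+ 2 + (zq t - yq t) ^+ 2 + (zl t - yl t) ^+ 2.
pose E (t : R) := expR (- (6 * beta * t)).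
pose D' t := 2 * (zm t - ym t) * (drift_m h (zm t) (zl t) - drift_m h (ym t) (yl t)) +
  2 * (zq t - yq t) * (drift_q h (zq t) (zl t) - drift_q h (yq t) (yl t)) +
  2 * (zl t - yl t) * (drift_l beta h (zm t) (zl t) - drift_l beta h (ym t) (yl t)).
have dD (t : R) : 0 < t -> is_derive t 1 D (D' t).
  move=> t0; have [ym1 yq1 yl1] := dy _ t0; have [zm1 zq1 zl1] := dz _ t0.
  have sq (y z : R -> R) a b : is_derive t 1 y a -> is_derive t 1 z b ->
      is_derive t 1 (fun t => (z t - y t) ^+ 2) (2 * (z t - y t) * (b - a)).
    by move=> ya zb; have := is_derive_exp 2 (is_derive_sub zb ya); rewrite /= expr1.
  exact: is_derive_add (is_derive_add (sq _ _ _ _ ym1 zm1) (sq _ _ _ _ yq1 zq1)) (sq _ _ _ _ yl1 zl1).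
have dE (t : R) : is_derive t 1 E (- (6 * beta) * E t).
  have dk : is_derive t 1 (fun t => - (6 * beta * t)) (- (0 * t + 6 * beta * 1)).
    apply: is_derive_opp; exact: (is_derive_mul (is_derive_cst (6 * beta) t 1) (is_derive_id t 1)).
  have := @is_derive_comp R expR (fun t => - (6 * beta * t)) t _ _ (is_derive_expR _) dk.
  by move=> H; apply: (is_derive_eq H); rewrite mul0r add0r mulr1 mulrC.
have dED (t : R) : 0 < t -> is_derive t 1 (fun t => E t * D t) (- (6 * beta) * E t * D t + E t * D' t).
  by move=> t0; apply: is_derive_mul (dE t) (dD t t0).
have cD : D t @[t --> (0:R)^'+] --> D 0.
  have sq (y z : R -> R) : y t @[t --> (0:R)^'+] --> y 0 -> z t @[t --> (0:R)^'+] --> z 0 ->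
      (z t - y t) ^+ 2 @[t --> (0:R)^'+] --> (z 0 - y 0) ^+ 2.
    move=> cy cz; apply: (continuous_cvg _ (@exprn_continuous R 2 _)).
    exact: cvgB.
  by apply: cvgD; [apply: cvgD|]; apply: sq.
have D0 : D 0 = 0 by rewrite /D m0 q0 l0 !subrr expr0n !addr0.
have cED : {within `[0, T], continuous (fun t => E t * D t)}.
  apply/(continuous_within_itvP _ T0); split.
  - move=> t; rewrite in_itv /= => /andP[t0 _]; exact: is_derive_continuous (dED t t0).
  - apply: cvgM cD; apply: cvg_at_right_filter.
    exact: is_derive_continuous (dE 0).
  - apply: cvg_at_left_filter; exact: is_derive_continuous (dED T T0).
have DT : D T <= 0.
  have : E T * D T - E 0 * D 0 <= 0 - 0.
    apply: (@derivative_le _ _ (fun=> 0) (fun t => - (6 * beta) * E t * D t + E t * D' t)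
      (fun=> 0) _ _ (ltW T0) cED).
    - by move=> t; exact: cvg_cst.
    - by move=> t /andP[t0 _]; exact: dED.
    - move=> t /andP[t0 _] /=.
      have := drift_one_sided_lipschitz h beta_gt0 (zm t) (zq t) (zl t) (ym t) (yq t) (yl t).
      rewrite -/(D' t) -/(D t) => H.
      have := ler_wpM2l (ltW (expR_gt0 (- (6 * beta * t)))) H; rewrite -/(E t).
      by move: (E t) (D t) (D' t) => *; lra.
  by rewrite D0 mulr0 !subr0 pmulr_rle0// expR_gt0.
have s1 := sqr_ge0 (zm T - ym T); have s2 := sqr_ge0 (zq T - yq T).
have s3 := sqr_ge0 (zl T - yl T).
have z (x y : R) : (x - y) ^+ 2 <= 0 -> x = y.
  move=> H; apply/eqP; rewrite -subr_eq0 -sqrf_eq0.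
  by rewrite eq_le H sqr_ge0.
move: DT; rewrite /D => DT.
by split; apply: z; lra.
Qed.

End limit_solution.

Lemma cvg_triple {R : realType} (T : Type) (F : set_system T) (FF : Filter F)
    (p : T -> R * R * R) (q : R * R * R) : p x @[x --> F] --> q ->
  [/\ (p x).1.1 @[x --> F] --> q.1.1, (p x).1.2 @[x --> F] --> q.1.2 &
      (p x).2 @[x --> F] --> q.2].
Proof.
move=> cp.
have c1 : (p x).1 @[x --> F] --> q.1.
  by exact: (cvg_comp _ _ cp (@cvg_fst _ _ (nbhs q.1) (nbhs q.2) _)).
split.
- by exact: (cvg_comp _ _ c1 (@cvg_fst _ _ (nbhs q.1.1) (nbhs q.1.2) _)).
- by exact: (cvg_comp _ _ c1 (@cvg_snd _ _ (nbhs q.1.1) (nbhs q.1.2) _)).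
- by exact: (cvg_comp _ _ cp (@cvg_snd _ _ (nbhs q.1) (nbhs q.2) _)).
Qed.

Section concentration.
Context {R : realType}.
Variables (beta h : R).
Hypothesis beta_gt0 : 0 < beta.
Variables ym yq yl : R -> R.
Hypothesis ym_ode : forall t : R, 0 <= t -> is_derive t 1 ym (drift_m h (ym t) (yl t)).
Hypothesis yq_ode : forall t : R, 0 <= t -> is_derive t 1 yq (drift_q h (yq t) (yl t)).
Hypothesis yl_ode : forall t : R, 0 <= t -> is_derive t 1 yl (drift_l beta h (ym t) (yl t)).

(** [lyapunov] seen as a function of the order parameters alone: at time 0 it is the test function
    for the initial condition, and its continuity gives right continuity along paths. *)
Let Phi (t : R) (p : R * R * R) : R := pos_part (1 - expR (- ((6 * beta + 1) * t)) *
  ((p.1.1 - ym t) ^+ 2 + (p.1.2 - yq t) ^+ 2 + (p.2 - yl t) ^+ 2)) ^+ 3.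

Lemma cvg_Phi (T : Type) (F : set_system T) (FF : Filter F) (k : T -> R) (p : T -> R * R * R)
    (t : R) (q : R * R * R) :
  expR (- ((6 * beta + 1) * k x)) @[x --> F] --> expR (- ((6 * beta + 1) * t)) ->
  ym (k x) @[x --> F] --> ym t -> yq (k x) @[x --> F] --> yq t ->
  yl (k x) @[x --> F] --> yl t -> p x @[x --> F] --> q ->
  Phi (k x) (p x) @[x --> F] --> Phi t q.
Proof.
move=> ce cm cq cl cp.
have [c11 c12 c2] := cvg_triple FF cp.
have sq (f g : T -> R) (a b : R) : f x @[x --> F] --> a -> g x @[x --> F] --> b ->
    (f x - g x) ^+ 2 @[x --> F] --> (a - b) ^+ 2.
  move=> cf cg; apply: (continuous_cvg _ (@exprn_continuous R 2 _)); exact: cvgB.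
apply: (continuous_cvg _ (@exprn_continuous R 3 _)).
apply: (continuous_cvg _ (@continuous_pos_part R _)).
apply: cvgB; first exact: cvg_cst.
apply: cvgM ce _.
by apply: cvgD (sq _ _ _ _ c2 cl); apply: cvgD (sq _ _ _ _ c11 cm) (sq _ _ _ _ c12 cq).
Qed.

Lemma continuous_Phi0 : continuous (Phi 0).
Proof. by move=> q; apply: (@cvg_Phi _ _ _ (fun=> 0)); try exact: cvg_cst; exact: cvg_id. Qed.

Lemma right_continuous_Phi (p : R -> R * R * R) (t : R) : 0 <= t ->
  p s @[s --> t^'+] --> p t -> Phi s (p s) @[s --> t^'+] --> Phi t (p t).
Proof.
move=> t0 cp; apply: (@cvg_Phi _ _ _ id) cp.
- apply: cvg_at_right_filter; apply: (continuous_cvg _ (@continuous_expR R _)).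
  by apply: cvgN; apply: cvgM; [exact: cvg_cst|exact: cvg_id].
- by apply: cvg_at_right_filter; exact: is_derive_continuous (ym_ode t0).
- by apply: cvg_at_right_filter; exact: is_derive_continuous (yq_ode t0).
- by apply: cvg_at_right_filter; exact: is_derive_continuous (yl_ode t0).
Qed.

Lemma order_parameters_concentration (eta : nat -> R) (N : nat)
    (etaP : forall j, eta j = 1 \/ eta j = -1) (N_gt0 : (0 < N)%N)
    (d : measure_display) (T : measurableType d) (Q : probability T R)
    (X : T -> cadlag R (config N * R)%type)
    (X_dyn : markov_process_with_generator Q (fun t w => X w t)
       (@micro_domain R N) (@micro_generator R beta h eta N))
    (tau : nat) (a : R) : 0 < a -> a < 1 ->
  exists2 A : set T, measurable A &
    (Q A <= ((1 - \int[Q]_w Phi 0 (order_parameters eta (X w 0)) +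
       drift_error beta eta N * tau%:R) / a)%:E)%E /\
    forall w, ~ A w -> forall t, 0 <= t <= tau%:R ->
      expR (- ((6 * beta + 1) * t)) *
      sqdist eta (ym t) (yq t) (yl t) (X w t).1 (X w t).2 <= a.
Proof.
move=> a0 a1; have [P [Psg Pgen PX]] := X_dyn.
have eta1 j : `|eta j| = 1 by case: (etaP j) => ->; rewrite ?normrN normr1.
pose f := @lyapunov R beta eta N ym yq yl.
pose g := @lyapunov_dt R beta h eta N ym yq yl.
have c0 := drift_error_ge0 beta eta N.
have Df t : micro_domain (f t) by have [] := @lyapunov_micro_domain R beta eta N ym yq yl t.
have Dg t : micro_domain (g t) by exact: lyapunov_dt_micro_domain.
have lower t s x : 0 <= t -> 0 <= s -> t + s <= tau%:R ->
    f t x - drift_error beta eta N * s <= \int[P s x]_y f (t + s) y.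
  apply: (@semigroup_lower_bound _ _ _ P (@micro_domain R N) _ Psg Pgen _ _ f g tau%:R) => //.
  - exact: micro_domain_bounded.
  - by move=> k; exact: micro_generator_bounded.
  - exact: lyapunov_ge0.
  - by move=> u /andP[u0 _]; exact: lyapunov_right_derivative.
  - by move=> u /andP[u0 _]; exact: lyapunov_left_continuous.
  - by move=> u /andP[u0 _] z; exact: generator_lyapunov.
have [|||w t /andP[t0 _]|A mA [QA HA]] :=
  @markov_maximal _ _ _ _ _ Q (fun t w => X w t) P PX f tau _ c0 _ _ _ lower a a0 (ltW a1).
- by move=> t _; have [] := micro_domain_bounded (Df t).
- exact: lyapunov_ge0.
- exact: lyapunov_le1.
- have [rc _ _] := cadlagP (order_parameter_path eta (X w)).
  exact: (right_continuous_Phi t0 (rc t t0)).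
exists A => //; split => // w nA t tI.
have := HA w nA t tI; rewrite /f /lyapunov /=.
set r := scaled_dist _ _ _ _ _ _ _ _.
move=> Hr; rewrite -/(scaled_dist beta eta ym yq yl t (X w t).1 (X w t).2) -/r.
rewrite leNgt; apply/negP => ar.
have r0 : 0 <= r by exact: scaled_dist_ge0.
(* For r > 1 the Lyapunov function vanishes, contradicting 1 - a > 0. Otherwise (1 - r)^3 <= 1 - r
   gives r <= a. *)
have [r1|r1] := leP r 1; last by move: Hr; rewrite pos_part_neg ?expr0n /=; lra.
move: Hr; rewrite pos_part_pos ?subr_ge0// => Hr.
have : (1 - r) ^+ 3 <= 1 - r by rewrite -[leRHS]expr1 ler_wiXn2l//; lra.
by lra.
Qed.

End concentration.

Section stopped_path.
Context {R : realType}.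
Variables (beta h : R) (ym yq yl : R -> R).
Hypothesis ym_ode : forall t : R, 0 <= t -> is_derive t 1 ym (drift_m h (ym t) (yl t)).
Hypothesis yq_ode : forall t : R, 0 <= t -> is_derive t 1 yq (drift_q h (yq t) (yl t)).
Hypothesis yl_ode : forall t : R, 0 <= t -> is_derive t 1 yl (drift_l beta h (ym t) (yl t)).

(** The solution is frozen for negative times because [is_cadlag] asks paths to be constant
    there. *)
Definition path_from0 (t : R) : R * R * R :=
  (ym (pos_part t), yq (pos_part t), yl (pos_part t)).

Lemma continuous_path_from0 : continuous path_from0.
Proof.
move=> t; have p0 := pos_part_ge0 t; have cp := @continuous_pos_part R t.
have cm : ym (pos_part s) @[s --> t] --> ym (pos_part t).
  by exact: (continuous_cvg _ (is_derive_continuous (ym_ode p0)) cp).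
have cq : yq (pos_part s) @[s --> t] --> yq (pos_part t).
  by exact: (continuous_cvg _ (is_derive_continuous (yq_ode p0)) cp).
have cl : yl (pos_part s) @[s --> t] --> yl (pos_part t).
  by exact: (continuous_cvg _ (is_derive_continuous (yl_ode p0)) cp).
exact: (cvg_pair (cvg_pair cm cq) cl).
Qed.

Lemma is_cadlag_path_from0 : is_cadlag path_from0.
Proof.
split.
- by move=> t _; apply: cvg_at_right_filter; exact: continuous_path_from0.
- move=> t _; exists (path_from0 t).
  by apply: cvg_at_left_filter; exact: continuous_path_from0.
- by move=> t t0; rewrite /path_from0 pos_part_neg// pos_part_pos.
Qed.

Lemma limit_ode_path_from0 : limit_ode beta h (ym 0, yq 0, yl 0) path_from0.
Proof.
have E (y : R -> R) (t b : R) : 0 < t -> is_derive t 1 y b ->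
    is_derive t 1 (fun s => y (pos_part s)) b.
  move=> t0; apply: near_eq_is_derive; near=> s.
  have s0 : 0 < s by near: s; exact: lt_nbhsr.
  by rewrite pos_part_pos// ltW.
split.
- by rewrite /path_from0 pos_part_pos.
- by apply: cvg_at_right_filter; exact: continuous_path_from0.
- move=> t t0; rewrite /path_from0 /= (pos_part_pos (ltW t0)).
  by split; apply: E => //; [apply: ym_ode|apply: yq_ode|apply: yl_ode]; exact: ltW.
Unshelve. all: by end_near. Qed.

End stopped_path.

Lemma cvg_drift_error {R : realType} (beta : R) (eta : nat -> R) :
  (\sum_(j < N) eta j) / N%:R @[N --> \oo] --> 0 ->
  drift_error beta eta N @[N --> \oo] --> 0.
Proof.
move=> lln.
have iN : (N%:R : R)^-1 @[N --> \oo] --> 0.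
  by rewrite -(cvg_shiftS (fun N => (N%:R : R)^-1)); exact: cvg_harmonic.
rewrite -[X in _ --> X](_ : 3 * (4 * (2 + beta ^+ 2) * 0 ^+ 2 + 8 * (2 + beta ^+ 2) * 0) = 0 :> R).
  apply: cvgM; first exact: cvg_cst.
  apply: cvgD; (apply: cvgM; first exact: cvg_cst); last exact: iN.
  exact: (continuous_cvg _ (@exprn_continuous R 2 _) lln).
by rewrite expr0n !mulr0 addr0 mulr0.
Qed.

Lemma ball_of_sqdist {R : realType} (eta : nat -> R) N (x : config N * R) (a b c e : R) :
  0 < e -> sqdist eta a b c x.1 x.2 < e ^+ 2 ->
  ball ((a, b, c) : R * R * R) e (order_parameters eta x).
Proof.
move=> e0; rewrite /sqdist => H.
have s1 := sqr_ge0 (magn x.1 - a); have s2 := sqr_ge0 (stag eta x.1 - b).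
have s3 := sqr_ge0 (x.2 - c).
have B (u v : R) : (u - v) ^+ 2 < e ^+ 2 -> ball v e u.
  move=> uv; rewrite /ball /= distrC.
  by rewrite -(ltr_pXn2r (n := 2)) ?nnegrE ?normr_ge0 ?(ltW e0)// real_normK ?num_real.
move: s1 s2 s3 H; set u := (_ - a) ^+ 2; set v := (_ - b) ^+ 2; set w := (_ - c) ^+ 2 => s1 s2 s3 H.
split; [split; [apply: (B (magn x.1))|apply: (B (stag eta x.1))]|apply: (B x.2)].
- by rewrite -/u; lra.
- by rewrite -/v; lra.
- by rewrite -/w; lra.
Qed.

Theorem theorem2p1 (R : realType) (beta h : R) (beta_gt0 : 0 < beta) (h_ge0 : 0 <= h)
    (d0 : measure_display) (Omega : measurableType d0) (P : probability Omega R)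
    (eta : nat -> {RV P >-> R}) (eta_field : random_field eta)
    (d : nat -> measure_display) (T : forall N, measurableType (d N))
    (Q : forall N, Omega -> probability (T N) R)
    (X : forall N, Omega -> T N -> cadlag R (config N * R)%type)
    (X_dynamics : forall N omega, (0 < N)%N ->
       markov_process_with_generator (Q N omega) (fun t w => X N omega w t)
         (@micro_domain R N) (@micro_generator R beta h (fun j => eta j omega) N))
    (m0 q0 lambda0 : R)
    (X_init : {ae P, forall omega,
       weakly_cvg_cst (fun N => Q N omega)
         (fun N w => order_parameters (fun j => eta j omega) (X N omega w 0))
         (m0, q0, lambda0)}) :
  exists y : cadlag R (R * R * R)%type,
    [/\ limit_ode beta h (m0, q0, lambda0) y,
        forall z : R -> R * R * R, limit_ode beta h (m0, q0, lambda0) z ->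
          forall t : R, 0 <= t -> z t = y t &
        {ae P, forall omega,
          weakly_cvg_cst (fun N => Q N omega)
            (fun N w => order_parameter_path (fun j => eta j omega) (X N omega w))
            y}].
Proof.
have [ym [yq [yl [[ym0 yq0 yl0] [dm dq dl]]]]] := limit_ode_exists h beta_gt0 m0 q0 lambda0.
have ode := limit_ode_path_from0 dm dq dl; rewrite ym0 yq0 yl0 in ode.
exists (Cadlag (is_cadlag_path_from0 dm dq dl)); split => //=.
  move=> z [z0 cz dz] t t0.
  rewrite /path_from0 pos_part_pos//.
  have rc (y : R -> R) (b : R) : is_derive (0 : R) 1 y b -> y t @[t --> (0:R)^'+] --> y 0.
    by move=> yb; apply: cvg_at_right_filter; exact: is_derive_continuous yb.
  have [c11 c12 c2] := cvg_triple _ cz.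
  have [||||zm zq zl] := @limit_ode_unique R beta h beta_gt0 ym yq yl
    (fun t => (z t).1.1) (fun t => (z t).1.2) (fun t => (z t).2) t _ _ _ _ dz t0.
  - by rewrite z0.
  - by split; [exact: rc (dm 0 _)|exact: rc (dq 0 _)|exact: rc (dl 0 _)].
  - by split; [exact: c11|exact: c12|exact: c2].
  - by move=> s /ltW s0; split; [exact: dm|exact: dq|exact: dl].
  by rewrite -zm -zq -zl; case: (z t) => -[].
(* The disorder is restricted only here, to the event where the initial condition converges and the
   law of large numbers holds. *)
apply: filterS2 X_init (random_field_lln eta_field) => omega init lln.
apply: weakly_cvg_cst_skorokhod => tau e p e0 p0.
pose eta' j := eta j omega.
have etaP j : eta' j = 1 \/ eta' j = -1 by case: eta_field => + _ _; exact.
pose K := expR ((6 * beta + 1) * tau%:R).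
have K0 : 0 < K by exact: expR_gt0.
(* Undoing the weight on [0, tau] costs a factor at most K, so the squared distance is at most K a
   <= e^2 / 2. The cap 1/2 ensures a < 1. *)
pose a := Num.min 2^-1 (e ^+ 2 / (2 * K)).
have a0 : 0 < a by rewrite lt_min invr_gt0 ltr0n /= divr_gt0 ?exprn_gt0 ?mulr_gt0.
have a1 : a < 1 by rewrite gt_min; apply/orP; left; lra.
pose Phi0 (x : R * R * R) := pos_part (1 - expR (- ((6 * beta + 1) * 0)) *
  ((x.1.1 - ym 0) ^+ 2 + (x.1.2 - yq 0) ^+ 2 + (x.2 - yl 0) ^+ 2)) ^+ 3.
pose E N := \int[Q N omega]_w Phi0 (order_parameters eta' (X N omega w 0)).
(* [Phi0] is continuous, bounded by 1, and equal to 1 at the limiting initial condition. *)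
have cE : E N @[N --> \oo] --> (1 : R).
  have Phi_le1 x : `|Phi0 x| <= 1.
    rewrite ger0_norm ?exprn_ge0 ?pos_part_ge0// exprn_ile1 ?pos_part_ge0//.
    rewrite /pos_part ge_max ler01 andbT gerBl mulr_ge0 ?expR_ge0//.
    by rewrite !addr_ge0 ?sqr_ge0.
  have := init Phi0 (@continuous_Phi0 R beta ym yq yl).
  have -> : Phi0 (m0, q0, lambda0) = 1.
    rewrite /Phi0 /= ym0 yq0 yl0 !subrr expr0n /= !addr0 mulr0 subr0.
    by rewrite pos_part_pos// expr1n.
  move=> /(_ _) cvgE; apply: fine_cvg; apply: cvgE.
  by exists 1; split => // k k1 x _; exact: le_trans (Phi_le1 x) (ltW k1).
have cu : (1 - E N + drift_error beta eta' N * tau%:R) / a @[N --> \oo] --> (0 : R).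
  rewrite -[X in _ --> X](_ : (1 - 1 + 0 * tau%:R) / a = 0); last first.
    by rewrite subrr mul0r addr0 mul0r.
  apply: cvgM; last exact: cvg_cst.
  apply: cvgD; first by apply: cvgB; [exact: cvg_cst|exact: cE].
  by apply: cvgM; [exact: cvg_drift_error lln|exact: cvg_cst].
near=> N.
have N0 : (0 < N)%N by near: N; exact: nbhs_infty_gt.
have [A mA [QA HA]] := order_parameters_concentration beta_gt0 dm dq dl etaP N0
  (X_dynamics N omega N0) tau a0 a1.
exists A => //; split.
  apply: (le_trans QA); rewrite lee_fin; apply: ltW.
  by near: N; apply: cvgr_lt cu _ p0.
move=> w nA t /andP[t0 tT]; rewrite /= /path_from0 pos_part_pos//.
apply: ball_of_sqdist => //.
have /HA := nA; move=> /(_ t); rewrite t0 tT => /(_ isT).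
rewrite expRN -ler_pdivlMl ?invr_gt0 ?expR_gt0// invrK => H; apply: (le_lt_trans H).
have tK : expR ((6 * beta + 1) * t) <= K.
  by rewrite ler_expR ler_wpM2l// addr_ge0// mulr_ge0// ltW.
apply: (@le_lt_trans _ _ (K * a)); first by rewrite ler_pM2r.
apply: (@le_lt_trans _ _ (K * (e ^+ 2 / (2 * K)))).
  by rewrite ler_pM2l// ge_min lexx orbT.
have -> : K * (e ^+ 2 / (2 * K)) = e ^+ 2 / 2 by field; exact: lt0r_neq0.
have : 0 < e ^+ 2 by rewrite exprn_gt0.
by move: (e ^+ 2) => *; lra.
Unshelve. all: by end_near. Qed.
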